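(* Let $X_K=\{x_1,\dots,x_K\}\subset\mathbf{S}^n$ be a set of points not contained in any closed hemisphere, and let $\mu_1,\dots,\mu_K$ be numbers with $\mu_i>0$ for all $i$, $$\sum_{i=1}^K\mu_i=\sigma(\mathbf{S}^n),$$ and such that for any (solid) polyhedral convex cone $V\neq\mathbb{R}^{n+1}$ with vertex at $\mathcal{O}$, possibly degenerate, $$\sum_{i:\,x_i\notin \mathbf{S}^n\cap V}\mu_i>\sigma\big((\mathbf{S}^n\cap V)^*\big).$$ Then there exists a polytope $\tilde P\in\mathcal{F}_K^n$ with radial function $\tilde\rho$ and support function $\tilde h$ such that $$\mathcal{Q}_K[\tilde h,\tilde\rho]=\inf_{\mathcal{A}_K}\mathcal{Q}_K[h,p]=\inf_{\mathcal{F}_K^n}\mathcal{Q}_K[h,\rho].$$ The pair $(\tilde h,\tilde\rho)$ is unique up to rescaling $(c\tilde h,c\tilde\rho)$ with any constant $c>0$.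
   Context: $\mathbf{S}^n$ is the unit sphere in $\mathbb{R}^{n+1}$, $n\ge1$, centered at the origin $\mathcal{O}$, and $\sigma$ is the standard $n$-dimensional Lebesgue measure on $\mathbf{S}^n$. For $\omega\subset\mathbf{S}^n$, $\omega^*=\{y\in\mathbf{S}^n:\langle x,y\rangle\le0\ \forall x\in\omega\}$. $\mathcal{F}^n$ is the set of boundaries of compact convex sets in $\mathbb{R}^{n+1}$ containing $\mathcal{O}$ in their interior; for $F\in\mathcal{F}^n$, its radial function $\rho(x)$ is the distance from $\mathcal{O}$ to the point where the ray from $\mathcal{O}$ in direction $x\in\mathbf{S}^n$ meets $F$, and its support function is $h(N)=\sup_{x\in\mathbf{S}^n}\rho(x)\langle x,N\rangle$. $\mathcal{F}_K^n$ is the set of convex polytopes in $\mathcal{F}^n$ all of whose vertices lie on the rays from $\mathcal{O}$ through $x_1,\dots,x_K$. The admissible set is $$\mathcal{A}_K=\{(h,p)\in C(\mathbf{S}^n)\times\mathbb{R}^K: h>0,\ p_i>0\ \forall i,\ \log h(N)-\log p_i\ge\log\langle x_i,N\rangle \text{ for all } i \text{ and all } N\in\mathbf{S}^n \text{ with }\langle x_i,N\rangle>0\},$$ and $\mathcal{Q}_K[h,p]=\int_{\mathbf{S}^n}\log h(N)\,d\sigma(N)-\sum_{i=1}^K\mu_i\log p_i$. For a polytope $P\in\mathcal{F}_K^n$ with support function $h$ and radial function $\rho$, $\mathcal{Q}_K[h,\rho]$ means $\mathcal{Q}_K[h,p]$ with $p=(\rho(x_1),\dots,\rho(x_K))$.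 *)

(* Defs.v *)
From HB Require Import structures.
From mathcomp Require Import all_boot all_order all_algebra.
From mathcomp Require Import all_classical all_reals all_analysis.
Set Implicit Arguments. Unset Strict Implicit. Unset Printing Implicit Defensive.
Import Order.TTheory GRing.Theory Num.Theory.
Import numFieldNormedType.Exports.
Local Open Scope classical_set_scope.
Local Open Scope ring_scope.

Definition dotp (R : realType) (n : nat) (x y : 'rV[R]_(n.+1)) : R :=
  \sum_(i < n.+1) x 0 i * y 0 i.

Definition sphere (R : realType) (n : nat) : set 'rV[R]_(n.+1) :=
  [set x | dotp x x = 1].
Arguments sphere : clear implicits.

Definition polar_set (R : realType) (n : nat) (w : set 'rV[R]_(n.+1))
  : set 'rV[R]_(n.+1) :=
  [set y | sphere R n y /\ forall x, w x -> dotp x y <= 0].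

Definition BorelR (R : realType) (n : nat) :=
  g_sigma_algebraType (@open 'rV[R]_(n.+1)).

(* sigma(S^n): omega_0 = 2, omega_1 = 2 pi, omega_{m+2} = 2 pi omega_m/(m+1)
   (= 2 pi^{(n+1)/2} / Gamma((n+1)/2)) *)
Fixpoint sphere_area (R : realType) (n : nat) : R :=
  match n with
  | 0 => 2
  | 1 => 2 * pi
  | (m.+1 as k).+1 => 2 * pi * sphere_area R m / k%:R
  end.

(* sigma is the standard n-dimensional Lebesgue (surface) measure on S^n,
   viewed as a Borel measure on R^{n+1}: it is carried by S^n, is invariant
   under all orthogonal transformations of R^{n+1}, and has total mass
   |S^n|.  (These properties characterize it uniquely.) *)
Definition standard_sphere_measure (R : realType) (n : nat)
  (sigma : {measure set (BorelR R n) -> \bar R}) : Prop :=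
  [/\ sigma (~` sphere R n) = 0%E,
      sigma (sphere R n) = (sphere_area R n)%:E &
      forall f : 'rV[R]_(n.+1) -> 'rV[R]_(n.+1),
        (forall u v, dotp (f u) (f v) = dotp u v) ->
        forall A : set (BorelR R n), measurable A ->
          sigma (f @^-1` A) = sigma A].

Definition polyhedral_cone (R : realType) (n : nat) (V : set 'rV[R]_(n.+1))
  : Prop :=
  exists (m : nat) (v : 'I_m.+1 -> 'rV[R]_(n.+1)),
    (forall j, v j != 0) /\
    V = [set y | exists c : 'I_m.+1 -> R,
                   (forall j, 0 <= c j) /\ y = \sum_j c j *: v j].

(* radial function of a body P (boundary F of P): for a unit vector x,
   the distance from O to the point where the ray through x meets F *)
Definition radial (R : realType) (n : nat) (P : set 'rV[R]_(n.+1))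
  (x : 'rV[R]_(n.+1)) : R :=
  sup [set t : R | 0 <= t /\ P (t *: x)].

Definition support_fn (R : realType) (n : nat) (P : set 'rV[R]_(n.+1))
  (N : 'rV[R]_(n.+1)) : R :=
  sup [set radial P x * dotp x N | x in sphere R n].

(* F_K^n (identified with the corresponding solid bodies): convex polytopes
   containing O in their interior, all of whose vertices lie on the rays
   from O through x_1, ..., x_K; i.e. convex hulls of finitely many points
   t_i x_i (t_i > 0, i in J) having O as an interior point *)
Definition polytopeK (R : realType) (n K : nat) (x : 'I_K -> 'rV[R]_(n.+1))
  (P : set 'rV[R]_(n.+1)) : Prop :=
  exists (J : {set 'I_K}) (t : 'I_K -> R),
    (forall i, 0 < t i) /\
    P = [set y | exists c : 'I_K -> R,
           [/\ forall i, 0 <= c i, forall i, i \notin J -> c i = 0,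
               \sum_i c i = 1 & y = \sum_i (c i * t i) *: x i]] /\
    (interior P) 0.

Definition admissible (R : realType) (n K : nat) (x : 'I_K -> 'rV[R]_(n.+1))
  (h : 'rV[R]_(n.+1) -> R) (p : 'I_K -> R) : Prop :=
  [/\ {within sphere R n, continuous h},
      forall N, sphere R n N -> 0 < h N,
      forall i, 0 < p i &
      forall i N, sphere R n N -> 0 < dotp (x i) N ->
        ln (h N) - ln (p i) >= ln (dotp (x i) N)].

Definition QK (R : realType) (n K : nat)
  (sigma : {measure set (BorelR R n) -> \bar R}) (mu : 'I_K -> R)
  (h : 'rV[R]_(n.+1) -> R) (p : 'I_K -> R) : \bar R :=
  ((\int[sigma]_(N in (sphere R n : set (BorelR R n))) (ln (h N))%:E)
    - (\sum_i mu i * ln (p i))%:E)%E.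

(* Main.v *)
Require Import Defs.
From HB Require Import structures.
From mathcomp Require Import all_boot all_order all_algebra.
From mathcomp Require Import all_classical all_reals all_analysis.
From mathcomp Require Import measurable_realfun ring lra.
Import Order.TTheory GRing.Theory Num.Theory.
Import numFieldNormedType.Exports.
Local Open Scope classical_set_scope.
Local Open Scope ring_scope.

(* For fixed p the least h with (h, p) admissible is the maximum of the linear
   forms p_i <x_i, .>, so the infimum over admissible pairs is that of a function
   Phi on R^K, Phi s = Q[h_p, p] with p_i = exp s_i, which is Lipschitz and
   invariant under adding constants to s. For I nonempty and proper, the cone
   spanned by the x_i with i in I turns the hypothesis into
     sum_(i in I) mu_i < sigma {N | <x_i, N> > 0 for some i in I},
   and a layer-cake decomposition along the levels of s then shows that Phi grows
   linearly in max s - min s. Hence a minimizer s exists; the radial and support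
   functions of the hull of the points exp(s_i) x_i have an energy at most Phi s.
   At a minimizer the part of the sphere where the maximum is attained in I has
   mass at least sum_(i in I) mu_i. If two minimizers differ by a non-constant
   vector, applying this to the indices I where the difference is largest for
   one minimizer, and to the complement of I for the other, yields two disjoint
   parts of the sphere that exhaust its mass; the gap between them contains a
   nonempty open set, which has positive mass since sigma is invariant under
   reflections. *)

Set Implicit Arguments. Unset Strict Implicit. Unset Printing Implicit Defensive.

(** * Dot product and sphere *)

Section DotProduct.
Variables (R : realType) (n : nat).
Implicit Types (x y z : 'rV[R]_(n.+1)) (c : R).

Lemma dotpC x y : dotp x y = dotp y x.
Proof. by apply: eq_bigr => i _; rewrite mulrC. Qed.

Lemma dotpDl x y z : dotp (x + y) z = dotp x z + dotp y z.
Proof. by rewrite -big_split; apply: eq_bigr => i _; rewrite mxE mulrDl. Qed.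

Lemma dotpZl c x y : dotp (c *: x) y = c * dotp x y.
Proof. by rewrite mulr_sumr; apply: eq_bigr => i _; rewrite mxE mulrA. Qed.

Lemma dotpNl x y : dotp (- x) y = - dotp x y.
Proof. by rewrite -scaleN1r dotpZl mulN1r. Qed.

Lemma dotpBl x y z : dotp (x - y) z = dotp x z - dotp y z.
Proof. by rewrite dotpDl dotpNl. Qed.

Lemma dotp0l x : dotp 0 x = 0.
Proof. by rewrite -(scale0r 0) dotpZl mul0r. Qed.

Lemma dotpDr x y z : dotp z (x + y) = dotp z x + dotp z y.
Proof. by rewrite dotpC dotpDl !(dotpC z). Qed.

Lemma dotpZr c x y : dotp x (c *: y) = c * dotp x y.
Proof. by rewrite dotpC dotpZl dotpC. Qed.

Lemma dotpNr x y : dotp x (- y) = - dotp x y.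
Proof. by rewrite dotpC dotpNl dotpC. Qed.

Lemma dotpBr x y z : dotp z (x - y) = dotp z x - dotp z y.
Proof. by rewrite dotpDr dotpNr. Qed.

Lemma dotp_suml (I : finType) (v : I -> 'rV[R]_(n.+1)) y :
  dotp (\sum_i v i) y = \sum_i dotp (v i) y.
Proof.
by apply: (big_morph (fun x => dotp x y)) => [u w|]; rewrite ?dotpDl ?dotp0l.
Qed.

Lemma dotpp_ge0 x : 0 <= dotp x x.
Proof. by apply: sumr_ge0 => i _; rewrite -expr2 sqr_ge0. Qed.

Lemma dotpp_eq0 x : (dotp x x == 0) = (x == 0).
Proof.
apply/idP/eqP => [|->]; last by rewrite dotp0l.
rewrite psumr_eq0 => [/allP x0|i _]; last by rewrite -expr2 sqr_ge0.
apply/rowP => i; rewrite mxE; apply/eqP.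
by have := x0 i (mem_index_enum _); rewrite mulf_eq0 orbb.
Qed.

Lemma dotpp_gt0 x : x != 0 -> 0 < dotp x x.
Proof. by move=> x0; rewrite lt_def dotpp_eq0 x0 dotpp_ge0. Qed.

Lemma dotp_sphere_le1 x y : sphere R n x -> sphere R n y -> dotp x y <= 1.
Proof.
rewrite /sphere /= => x1 y1; have := dotpp_ge0 (x - y).
by rewrite dotpBl !dotpBr x1 y1 (dotpC y x); lra.
Qed.

Lemma normalize_sphere x : x != 0 ->
  sphere R n ((Num.sqrt (dotp x x))^-1 *: x).
Proof.
move=> x0; rewrite /sphere /= dotpZl dotpZr mulrA -expr2 exprVn.
by rewrite sqr_sqrtr ?dotpp_ge0 // mulVf // dotpp_eq0.
Qed.

Lemma sphere_neq0 x : sphere R n x -> x != 0.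
Proof.
rewrite /sphere /= => x1; apply/eqP => x0.
by move: x1; rewrite x0 dotp0l => /eqP; rewrite eq_sym oner_eq0.
Qed.

Lemma sphereN x : sphere R n x -> sphere R n (- x).
Proof. by rewrite /sphere /= dotpNl dotpNr opprK. Qed.

Lemma sphere_nonempty : sphere R n !=set0.
Proof.
exists (delta_mx 0 0); rewrite /sphere /= /dotp (bigD1 ord0) //= big1.
  by rewrite mxE eqxx mulr1 addr0.
by move=> i i0; rewrite mxE (negbTE i0) andbF mulr0.
Qed.

Lemma sphere_scale_eq c x y : 0 < c -> sphere R n x -> sphere R n y ->
  y = c *: x -> y = x.
Proof.
rewrite /sphere /= => c0 x1 y1 yx; move: y1; rewrite yx dotpZl dotpZr x1 mulr1.
move=> c1; have -> : c = 1 by nra.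
by rewrite scale1r.
Qed.

Lemma continuous_mul (T : topologicalType) (f g : T -> R) :
  continuous f -> continuous g -> continuous (fun t => f t * g t).
Proof. by move=> fc gc t; apply: cvgM; [exact: fc|exact: gc]. Qed.

Lemma continuous_sub (T : topologicalType) (V : normedModType R) (f g : T -> V) :
  continuous f -> continuous g -> continuous (fun t => f t - g t).
Proof. by move=> fc gc t; apply: cvgB; [exact: fc|exact: gc]. Qed.

Lemma open_ltfun (T : topologicalType) (f g : T -> R) :
  continuous f -> continuous g -> open [set t | f t < g t].
Proof.
move=> fc gc.
have -> : [set t | f t < g t] = (fun t => g t - f t) @^-1` [set r | 0 < r].
  by apply/seteqP; split => t /=; rewrite subr_gt0.
by apply: open_comp; [move=> t _; exact: continuous_sub|exact: open_gt].
Qed.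

Lemma continuous_scale (T : topologicalType) (V : normedModType R)
    (f : T -> R) (g : T -> V) :
  continuous f -> continuous g -> continuous (fun t => f t *: g t).
Proof. by move=> fc gc t; apply: cvgZ; [exact: fc|exact: gc]. Qed.

Lemma continuous_sum (T : topologicalType) (I : Type) (r : seq I)
    (f : I -> T -> R) :
  (forall i, continuous (f i)) -> continuous (fun t => \sum_(i <- r) f i t).
Proof. by move=> fc; apply: continuous_big => //; exact: add_continuous. Qed.

Lemma dotp_continuous2 (T : topologicalType) (f g : T -> 'rV[R]_(n.+1)) :
  continuous f -> continuous g -> continuous (fun t => dotp (f t) (g t)).
Proof.
move=> fc gc; apply: continuous_sum => i t.
apply: cvgM.
  apply: (@continuous_comp _ _ _ f (fun M : 'rV[R]_(n.+1) => M 0 i)); first exact: fc.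
  exact: coord_continuous.
apply: (@continuous_comp _ _ _ g (fun M : 'rV[R]_(n.+1) => M 0 i)); first exact: gc.
exact: coord_continuous.
Qed.

Lemma dotp_continuousr x : continuous (dotp x).
Proof.
by apply: dotp_continuous2; [exact: cst_continuous|move=> t; apply: cvg_id].
Qed.

Lemma closed_sphere : closed (sphere R n).
Proof.
have -> : sphere R n = (fun x => dotp x x) @^-1` [set 1] by [].
apply: closed_comp; last exact: closed_eq.
by move=> x _; apply: dotp_continuous2 => t; apply: cvg_id.
Qed.

Lemma compact_box (m : nat) (a b : R) :
  compact [set v : 'rV[R]_m | forall i, `[a, b]%classic (v ord0 i)].
Proof.
by apply: (@rV_compact _ _ (fun=> `[a, b]%classic)) => i; exact: segment_compact.
Qed.

Lemma compact_sphere : compact (sphere R n).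
Proof.
apply: (subclosed_compact closed_sphere (@compact_box n.+1 (-1) 1)).
move=> x x1 i /=; rewrite in_itv /= -ler_norml.
rewrite -(@ler_pXn2r _ 2) ?nnegrE // expr1n real_normK ?num_real //.
move: x1; rewrite /sphere /= /dotp (bigD1 i) //= => <-.
by rewrite expr2 lerDl; apply: sumr_ge0 => k _; rewrite -expr2 sqr_ge0.
Qed.


(* The reflection exchanging u and v; for u = v it is the identity because
   0^-1 = 0. *)
Definition reflection (u v x : 'rV[R]_(n.+1)) : 'rV[R]_(n.+1) :=
  x - (2 * dotp x (u - v) / dotp (u - v) (u - v)) *: (u - v).

Lemma dotp_reflection u v x y :
  dotp (reflection u v x) (reflection u v y) = dotp x y.
Proof.
rewrite /reflection; move: (u - v) => w.
have [->|w0] := eqVneq w 0; first by rewrite !scaler0 !subr0.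
have w1 : dotp w w != 0 by rewrite dotpp_eq0.
rewrite !(dotpBl, dotpBr, dotpZl, dotpZr) (dotpC w y).
by field.
Qed.

(** Unit vectors satisfy 2<v, u - v> = -|u - v|^2. Reflections thus act transitively on the sphere,
    which [open_sarea_gt0] exploits. *)
Lemma reflectionE u v : sphere R n u -> sphere R n v -> reflection u v v = u.
Proof.
rewrite /reflection => u1 v1; have [->|uv] := eqVneq u v.
  by rewrite subrr scaler0 subr0.
have w0 : dotp (u - v) (u - v) != 0 by rewrite dotpp_eq0 subr_eq0.
have -> : 2 * dotp v (u - v) = - dotp (u - v) (u - v).
  move: u1 v1; rewrite /sphere /= !(dotpBl, dotpBr) (dotpC v u) => -> ->.
  by ring.
by rewrite mulNr mulfV // scaleN1r opprK addrC subrK.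
Qed.

Lemma continuous_reflection u v : continuous (reflection u v).
Proof.
rewrite /reflection; move: (u - v) => w.
have ci : continuous (fun x : 'rV[R]_(n.+1) => x) by move=> x; apply: cvg_id.
apply: continuous_sub => //; apply: continuous_scale; last exact: cst_continuous.
apply: continuous_mul; last exact: cst_continuous.
apply: continuous_mul; first exact: cst_continuous.
by apply: dotp_continuous2 => //; exact: cst_continuous.
Qed.

End DotProduct.

(** * Maxima of linear forms and convex hulls *)

Section MaxForm.
Variables (R : realType) (n K : nat) (x : 'I_K -> 'rV[R]_(n.+1)).
Implicit Types (A B : {set 'I_K}) (p : 'I_K -> R) (N : 'rV[R]_(n.+1)).

(** With base value 0 this is the positive part of the maximum of the forms. Over all indices, with
    positive [p], some form is positive at each point of the sphere ([ex_dotp_gt0]), so the base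
    value is invisible there. *)
Definition Hmax A p N : R := \big[Num.max/0]_(i in A) (p i * dotp (x i) N).

Lemma Hmax_ge A p N i : i \in A -> p i * dotp (x i) N <= Hmax A p N.
Proof.
by move=> iA; apply: (@le_bigmax_cond _ _ _ _ _ _ (fun i => p i * dotp (x i) N)).
Qed.

Lemma Hmax_ge0 A p N : 0 <= Hmax A p N.
Proof. exact: bigmax_ge_id. Qed.

Lemma Hmax_le A p N b : 0 <= b ->
  (forall i, i \in A -> p i * dotp (x i) N <= b) -> Hmax A p N <= b.
Proof. by move=> b0 pb; apply: bigmax_le. Qed.

Lemma continuous_Hmax A p : continuous (Hmax A p).
Proof.
apply: continuous_big => [|i _]; first exact: max_continuous.
by apply: continuous_mul; [exact: cst_continuous|exact: dotp_continuousr].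
Qed.

Lemma Hmax_setC A p N : Hmax [set: 'I_K] p N <= Num.max (Hmax A p N) (Hmax (~: A) p N).
Proof.
apply: Hmax_le => [|i _]; first by rewrite le_max Hmax_ge0.
rewrite le_max; have [iA|iA] := boolP (i \in A); first by rewrite Hmax_ge.
by rewrite (Hmax_ge (A := ~: A)) ?orbT // inE.
Qed.

Lemma Hmax_sub A B p N : A \subset B -> Hmax A p N <= Hmax B p N.
Proof.
move=> /fintype.subsetP AB; apply: Hmax_le => [|i /AB iB]; first exact: Hmax_ge0.
exact: Hmax_ge.
Qed.

(** A negative form would reverse the comparison of coefficients, but it lies below 0, which the
    right side dominates. *)
Lemma Hmax_scale_le A p q c N : 0 <= c -> (forall i, 0 < p i) ->
  (forall i, i \in A -> p i <= c * q i) -> Hmax A p N <= c * Hmax A q N.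
Proof.
move=> c0 p0 pq; apply: Hmax_le => [|i iA]; first by rewrite mulr_ge0 ?Hmax_ge0.
have [d0|d0] := ltP (dotp (x i) N) 0.
  apply: (@le_trans _ _ 0); last by rewrite mulr_ge0 ?Hmax_ge0.
  by have := p0 i; nra.
apply: (@le_trans _ _ (c * q i * dotp (x i) N)); first by rewrite ler_wpM2r ?pq.
by rewrite -mulrA ler_wpM2l // Hmax_ge.
Qed.

Lemma Hmax_scale A p q c N : 0 < c -> (forall i, 0 < p i) -> (forall i, 0 < q i) ->
  (forall i, i \in A -> p i = c * q i) -> Hmax A p N = c * Hmax A q N.
Proof.
move=> c0 p0 q0 pq; apply/eqP; rewrite eq_le; apply/andP; split.
  by apply: Hmax_scale_le => // [|i /pq ->]; first exact: ltW.
rewrite mulrC -ler_pdivlMr // mulrC; apply: Hmax_scale_le => //.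
  by rewrite invr_ge0 ltW.
by move=> i iA; rewrite pq // mulKf // gt_eqF.
Qed.

Lemma Hmax_homog A p c N : 0 <= c -> Hmax A p (c *: N) = c * Hmax A p N.
Proof.
move=> c0; rewrite [in LHS]/Hmax [in RHS]/Hmax.
elim/big_rec2: _ => [|i a b _ ->]; first by rewrite mulr0.
by rewrite maxr_pMr // dotpZr mulrCA.
Qed.

Hypothesis xS : forall i, sphere R n (x i).
Hypothesis xH : ~ (exists N, sphere R n N /\ forall i, 0 <= dotp (x i) N).

Lemma ex_dotp_gt0 N : sphere R n N -> exists i, 0 < dotp (x i) N.
Proof.
move=> NS; apply: contrapT => nx; apply: xH; exists (- N); split.
  exact: sphereN.
move=> i; rewrite dotpNr oppr_ge0 leNgt; apply/negP => xi; apply: nx.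
by exists i.
Qed.

Lemma Hmax_gt0 p N : (forall i, 0 < p i) -> sphere R n N ->
  0 < Hmax [set: 'I_K] p N.
Proof.
move=> p0 /ex_dotp_gt0[i xi].
apply: (@lt_le_trans _ _ (p i * dotp (x i) N)); first exact: mulr_gt0.
exact: Hmax_ge.
Qed.

Lemma Hmax_lbound p : (forall i, 0 < p i) ->
  exists2 c, 0 < c & forall N, sphere R n N -> c <= Hmax [set: 'I_K] p N.
Proof.
move=> p0; have [|N] := @EVT_min_rV _ _ (Hmax [set: 'I_K] p) _
  (sphere_nonempty R n) (@compact_sphere R n).
  exact/continuous_subspaceT/continuous_Hmax.
rewrite inE => NS Nm; exists (Hmax [set: 'I_K] p N); first exact: Hmax_gt0.
by move=> M MS; apply: Nm; rewrite inE.
Qed.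

End MaxForm.

(** Variational inequality at a nearest point: if <d, w> > 0, then |w - a d|^2 would decrease for
    small a. *)
Lemma dotp_le0_of_minimal (R : realType) (n : nat) (w d : 'rV[R]_(n.+1)) :
  (forall a, 0 <= a <= 1 -> dotp w w <= dotp (w - a *: d) (w - a *: d)) ->
  dotp d w <= 0.
Proof.
move=> wm; rewrite leNgt; apply/negP => e0.
have q0 := dotpp_ge0 d; have eq0 : 0 < dotp d w + dotp d d by lra.
(* With e = <d, w> and q = <d, d>, the step a = e / (e + q) lies in ]0, 1] and satisfies a q <= e,
   so -2 a e + a^2 q < 0. *)
have a0 : 0 < dotp d w / (dotp d w + dotp d d) by rewrite divr_gt0.
have ae : dotp d w / (dotp d w + dotp d d) * (dotp d w + dotp d d) = dotp d w.
  by rewrite divfK // gt_eqF.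
have {wm} := wm (dotp d w / (dotp d w + dotp d d)).
rewrite dotpBl !dotpBr !dotpZl !dotpZr (dotpC w d).
move: a0 ae; move: (_ / _) => a a0 ae.
have -> : 0 <= a <= 1 by apply/andP; split; nra.
by move=> /(_ isT); nra.
Qed.

Section Hull.
Variables (R : realType) (n K : nat) (x : 'I_K -> 'rV[R]_(n.+1)).
Implicit Types (J : {set 'I_K}) (t : 'I_K -> R) (N y v z : 'rV[R]_(n.+1)).

Definition hull J t : set 'rV[R]_(n.+1) :=
  [set y | exists c : 'I_K -> R,
     [/\ forall i, 0 <= c i, forall i, i \notin J -> c i = 0,
         \sum_i c i = 1 & y = \sum_i (c i * t i) *: x i]].

Lemma hull_segment J t y z a : hull J t y -> hull J t z -> 0 <= a <= 1 ->
  hull J t (z + a *: (y - z)).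
Proof.
move=> [c [c0 cJ c1 ->]] [d [d0 dJ d1 ->]] /andP[a0 a1].
exists (fun i => (1 - a) * d i + a * c i); split.
- by move=> i; have := c0 i; have := d0 i; nra.
- by move=> i iJ; rewrite cJ // dJ // !mulr0 addr0.
- by rewrite big_split /= -!mulr_sumr c1 d1; lra.
- rewrite -sumrB scaler_sumr -big_split /=; apply: eq_bigr => i _.
  by rewrite -scalerBl scalerA -scalerDl; congr (_ *: _); ring.
Qed.

Lemma hull_vertex J t i : i \in J -> hull J t (t i *: x i).
Proof.
move=> iJ; exists (fun j => (j == i)%:R); split => //.
- by move=> j jJ; case: eqVneq => // ji; rewrite ji iJ in jJ.
- by rewrite (bigD1 i) //= eqxx big1 ?addr0 // => j /negbTE ->.
rewrite (bigD1 i) //= eqxx mul1r big1 ?addr0 // => j /negbTE ->.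
by rewrite mul0r scale0r.
Qed.

Lemma hull_dotp_le J t N v b : hull J t v ->
  (forall i, i \in J -> t i * dotp (x i) N <= b) -> dotp v N <= b.
Proof.
move=> [c [c0 cJ c1 ->]] tb; rewrite dotp_suml -[b]mul1r -c1 mulr_suml.
apply: ler_sum => i _; rewrite dotpZl -mulrA.
have [iJ|/cJ ->] := boolP (i \in J); last by rewrite !mul0r.
by rewrite ler_wpM2l ?tb.
Qed.

(** The hull is the continuous image of a compact set of coefficient vectors, so the distance to [y]
    is minimized over coefficients. *)
Lemma hull_nearest J t y : hull J t !=set0 ->
  exists2 z, hull J t z & forall v, hull J t v ->
    dotp (y - z) (y - z) <= dotp (y - v) (y - v).
Proof.
move=> [_ [c0 [c00 c0J c01 _]]].
(* The degenerate segment [0, 0] forces the coefficients outside [J] to vanish. *)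
pose D := [set c : 'rV[R]_K | forall i,
             `[0, if i \in J then 1 else 0]%classic (c ord0 i)]
          `&` [set c | \sum_i c ord0 i = 1].
pose g (c : 'rV[R]_K) := \sum_i (c ord0 i * t i) *: x i.
have Dhull c : D c -> hull J t (g c).
  move=> [/= cD c1]; exists (fun i => c ord0 i); split => // i.
    by have := cD i; rewrite in_itv /= => /andP[].
  by move=> /negbTE iJ; have := cD i; rewrite in_itv /= iJ => /le_anti.
have hullD v : hull J t v -> exists2 c, D c & v = g c.
  move=> [c [cc0 cJ c1 ->]]; exists (\row_i c i); last first.
    by apply: eq_bigr => i _; rewrite mxE.
  split => /=; last by rewrite -[RHS]c1; apply: eq_bigr => i _; rewrite mxE.
  move=> i; rewrite in_itv /= mxE cc0 /=; case: ifPn => [_|/cJ -> //].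
  by rewrite -c1 (bigD1 i) //= lerDl; apply: sumr_ge0.
have ci i : continuous (fun c : 'rV[R]_K => c ord0 i).
  exact: coord_continuous.
have gc : continuous g.
  apply: continuous_big => [|i _]; first exact: add_continuous.
  apply: continuous_scale; last exact: cst_continuous.
  by apply: continuous_mul; [exact: ci|exact: cst_continuous].
have Dc : compact D.
  apply: compact_closedI.
    pose C (i : 'I_K) : set R := `[0, if i \in J then 1 else 0]%classic.
    by apply: (@rV_compact _ _ C) => i; exact: segment_compact.
  apply: (@closed_comp _ _ (fun c : 'rV[R]_K => \sum_i c ord0 i) [set 1]);
    last exact: closed_eq.
  by move=> c _; apply: continuous_sum => i; exact: ci.
have [|||c] := @EVT_min_rV _ _ (fun c => dotp (y - g c) (y - g c)) D.
- by have [|c Dc' _] := hullD (\sum_i (c0 i * t i) *: x i); [exists c0|exists c].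
- exact: Dc.
- apply: continuous_subspaceT.
  have yg : continuous (fun c => y - g c).
    by apply: continuous_sub => //; exact: cst_continuous.
  exact: dotp_continuous2.
rewrite inE => cD cm; exists (g c); first exact: Dhull.
by move=> v /hullD[d dD ->]; apply: cm; rewrite inE.
Qed.

(** The normal is the unit vector along y - z, with [z] the point of the hull nearest to [y]; the
    variational inequality keeps the hull behind [z]. *)
Lemma hull_separation J t y : hull J t !=set0 -> ~ hull J t y ->
  exists N z, [/\ sphere R n N, hull J t z, dotp z N < dotp y N &
    forall v, hull J t v -> dotp v N <= dotp z N].
Proof.
move=> /(hull_nearest y)[z zP zm] yP.
have w0 : y - z != 0 by apply/eqP => /subr0_eq yz; apply: yP; rewrite yz.
have w2 := dotpp_gt0 w0; have wS := normalize_sphere w0.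
have s0 : 0 < (Num.sqrt (dotp (y - z) (y - z)))^-1 by rewrite invr_gt0 sqrtr_gt0.
exists ((Num.sqrt (dotp (y - z) (y - z)))^-1 *: (y - z)), z; split => //.
  by rewrite -subr_gt0 -dotpBl dotpZr mulr_gt0.
move=> v vP; rewrite -subr_le0 -dotpBl dotpZr pmulr_rle0 //.
apply: dotp_le0_of_minimal => a a01.
by rewrite -addrA -opprD; apply: zm; exact: hull_segment.
Qed.

End Hull.

(** * Radial and support functions of polytopes *)

Section Polytope.
Variables (R : realType) (n K : nat) (x : 'I_K -> 'rV[R]_(n.+1)).
Hypothesis xS : forall i, sphere R n (x i).
Implicit Types (J : {set 'I_K}) (t p : 'I_K -> R) (N u v y : 'rV[R]_(n.+1)).

(** If c > 0 bounds the maximum of the forms from below on the sphere, the open ball of radius c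
    lies in the hull: a point outside the hull has <y, N> > c for a separating [N], hence norm above
    c. *)
Lemma hull_interior0 p :
  ~ (exists N, sphere R n N /\ forall i, 0 <= dotp (x i) N) ->
  (forall i, 0 < p i) -> (interior (hull x [set: 'I_K] p)) 0.
Proof.
move=> xH p0; have [c c0 cH] := Hmax_lbound xH p0.
have cdot : continuous (fun y : 'rV[R]_(n.+1) => dotp y y).
  by apply: dotp_continuous2 => y; apply: cvg_id.
apply: (@filterS _ (nbhs (0 : 'rV[R]_(n.+1))) _ [set y | dotp y y < c ^+ 2]); last first.
  apply: open_nbhs_nbhs; split; last by rewrite /= dotp0l exprn_gt0.
  apply: (@open_comp _ _ (fun y => dotp y y) [set r | r < c ^+ 2]); last exact: open_lt.
  by move=> y _; exact: cdot.
move=> y /= yc; apply: contrapT => yP.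
have [M MS] := sphere_nonempty R n; have [i0 _] := ex_dotp_gt0 xH MS.
have [|N [z [NS _ zy zm]]] := hull_separation _ yP.
  by exists (p i0 *: x i0); apply: hull_vertex.
have Hz : Hmax x [set: 'I_K] p N <= dotp z N.
  have [j xj] := ex_dotp_gt0 xH NS.
  have zp i : p i * dotp (x i) N <= dotp z N.
    by rewrite -dotpZl; apply: zm; apply: hull_vertex.
  apply: Hmax_le => [|i _]; last exact: zp.
  by apply: le_trans (zp j); rewrite mulr_ge0 ?ltW.
have cy : c < dotp y N by apply: le_lt_trans zy; apply: le_trans Hz; exact: cH.
(* Nonnegativity of |y - <y, N> N|^2 is the bound <y, N>^2 <= |y|^2. *)
have := dotpp_ge0 (y - dotp y N *: N).
rewrite dotpBl !dotpBr !dotpZl !dotpZr (dotpC N y) (NS : dotp N N = 1).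
by nra.
Qed.

Variables (J : {set 'I_K}) (t : 'I_K -> R).
Hypothesis t0 : forall i, 0 < t i.
Let P := hull x J t.
Hypothesis P0 : (interior P) 0.

Let P_0 : P 0. Proof. exact: nbhs_singleton. Qed.

Let radial_ubound u : sphere R n u ->
  ubound [set a : R | 0 <= a /\ P (a *: u)] (\sum_i t i).
Proof.
move=> uS a [a0 Pa].
have -> : a = dotp (a *: u) u by rewrite dotpZl (uS : dotp u u = 1) mulr1.
apply: (hull_dotp_le Pa) => i _.
apply: (@le_trans _ _ (t i)).
  by rewrite ler_piMr //; [exact: ltW|exact: dotp_sphere_le1].
by rewrite (bigD1 i) //= lerDl sumr_ge0 // => j _; rewrite ltW.
Qed.

Let radial_nonempty u : [set a : R | 0 <= a /\ P (a *: u)] !=set0.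
Proof. by exists 0; split => //; rewrite scale0r. Qed.

Lemma le_radial u a : sphere R n u -> 0 <= a -> P (a *: u) -> a <= radial P u.
Proof.
move=> uS a0 Pa; apply: ub_le_sup; last by split.
by exists (\sum_i t i); exact: radial_ubound.
Qed.

Lemma radial_le u b :
  (forall a, 0 <= a -> P (a *: u) -> a <= b) -> radial P u <= b.
Proof. by move=> ab; apply: ge_sup => // a [a0 Pa]; exact: ab. Qed.

Lemma radial_ge0 u : sphere R n u -> 0 <= radial P u.
Proof. by move=> uS; apply: le_radial => //; rewrite scale0r. Qed.

Lemma radial_gt0 u : sphere R n u -> 0 < radial P u.
Proof.
move=> uS; have cu : continuous (fun a : R => a *: u).
  apply: continuous_scale; last exact: cst_continuous.
  by move=> a; apply: cvg_id.
have : \forall a \near (0 : R), P (a *: u).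
  by apply: cu; rewrite scale0r.
move=> /nbhs_ballP[e /= e0 eP].
have e20 : 0 < e / 2 by rewrite divr_gt0.
apply: (lt_le_trans e20); apply: le_radial => //; first exact: ltW.
apply: eP; rewrite /ball /= sub0r normrN gtr0_norm //; lra.
Qed.

Let support_ubound N : sphere R n N ->
  has_ubound [set radial P u * dotp u N | u in sphere R n].
Proof.
move=> NS; exists (\sum_i t i) => _ [u uS <-].
apply: (@le_trans _ _ (radial P u)).
  by rewrite ler_piMr ?radial_ge0 // dotp_sphere_le1.
by apply: radial_le => a a0 Pa; apply: (radial_ubound uS).
Qed.

Lemma radial_le_support u N : sphere R n u -> sphere R n N ->
  radial P u * dotp u N <= support_fn P N.
Proof. by move=> uS NS; apply: ub_le_sup; [exact: support_ubound|exists u]. Qed.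

Lemma support_ge0 N : sphere R n N -> 0 <= support_fn P N.
Proof.
move=> NS; apply: le_trans (radial_le_support NS NS).
by rewrite (NS : dotp N N = 1) mulr1 radial_ge0.
Qed.

(** Together with [le_support] this identifies [support_fn], a supremum over boundary points, with
    the supremum of <., N> over the body. Directions with <u, N> <= 0 only need b >= 0, which holds
    because O lies in the body. *)
Lemma support_le N b : sphere R n N ->
  (forall v, P v -> dotp v N <= b) -> support_fn P N <= b.
Proof.
move=> NS vb; apply: ge_sup; first by exists (radial P N * dotp N N), N.
move=> _ [u uS <-]; have b0 : 0 <= b by rewrite -(dotp0l N) vb.
have [d0|d0] := leP (dotp u N) 0.
  by apply: le_trans b0; rewrite mulr_ge0_le0 ?radial_ge0.
rewrite -ler_pdivlMr //; apply: radial_le => a a0 Pa.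
by rewrite ler_pdivlMr // -dotpZl vb.
Qed.

Lemma le_support v N : sphere R n N -> P v -> dotp v N <= support_fn P N.
Proof.
move=> NS Pv; have [->|v0] := eqVneq v 0; first by rewrite dotp0l support_ge0.
have uS := normalize_sphere v0; set u := _ *: v in uS.
have s0 : 0 < Num.sqrt (dotp v v) by rewrite sqrtr_gt0 dotpp_gt0.
have vu : v = Num.sqrt (dotp v v) *: u by rewrite scalerA mulfV ?scale1r // gt_eqF.
have -> : dotp v N = Num.sqrt (dotp v v) * dotp u N by rewrite -dotpZl -vu.
have [d0|d0] := leP (dotp u N) 0.
  by apply: le_trans (support_ge0 NS); rewrite mulr_ge0_le0 // ltW.
apply: le_trans (radial_le_support uS NS); rewrite ler_wpM2r //; first exact: ltW.
by apply: le_radial => //; rewrite -vu.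
Qed.

Lemma le_radial_vertex i : i \in J -> t i <= radial P (x i).
Proof. by move=> iJ; apply: le_radial; [exact: xS|exact: ltW|exact: hull_vertex]. Qed.

(** A linear form is bounded on the hull by its values at the points [t i *: x i] with i in [J], and
    [t i] is at most the radial value there. Indices outside [J] only contribute directions already
    present in the supremum. *)
Lemma support_Hmax N : sphere R n N ->
  support_fn P N = Hmax x [set: 'I_K] (fun i => radial P (x i)) N.
Proof.
move=> NS; apply/eqP; rewrite eq_le; apply/andP; split; last first.
  by apply: Hmax_le => [|i _]; [exact: support_ge0|exact: radial_le_support].
apply: support_le => // v Pv; apply: (hull_dotp_le Pv) => i iJ.
have [d0|d0] := leP (dotp (x i) N) 0.
  apply: (@le_trans _ _ 0); last exact: Hmax_ge0.
  by rewrite mulr_ge0_le0 // ltW.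
apply: (@le_trans _ _ (radial P (x i) * dotp (x i) N)); last exact: Hmax_ge.
by rewrite ler_wpM2r ?le_radial_vertex // ltW.
Qed.

(** By separation, the support function determines the body. *)
Lemma polytope_support y :
  (forall N, sphere R n N -> dotp y N <= support_fn P N) -> P y.
Proof.
move=> yN; apply: contrapT => yP.
have [|N [z [NS _ zy zm]]] := hull_separation _ yP; first by exists 0.
by have := le_lt_trans (le_trans (yN N NS) (support_le NS zm)) zy; rewrite ltxx.
Qed.

End Polytope.

(** Since a body is cut out by its support function, the assumed bound places the primed body inside
    c times the other one. *)
Lemma radial_scale_le (R : realType) (n K : nat) (x : 'I_K -> 'rV[R]_(n.+1))
    (xS : forall i, sphere R n (x i)) (J J' : {set 'I_K}) (t t' : 'I_K -> R) c u :
  (forall i, 0 < t i) -> (forall i, 0 < t' i) ->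
  (interior (hull x J t)) 0 -> (interior (hull x J' t')) 0 -> 0 < c ->
  (forall N, sphere R n N ->
     support_fn (hull x J' t') N <= c * support_fn (hull x J t) N) ->
  sphere R n u -> radial (hull x J' t') u <= c * radial (hull x J t) u.
Proof.
move=> t0 t'0 P0 P'0 c0 cs uS; apply: radial_le => // a a0 Pa.
rewrite mulrC -ler_pdivrMr //; apply: le_radial => //.
  by rewrite divr_ge0 // ltW.
apply: polytope_support => // N NS.
rewrite mulrC -scalerA dotpZl mulrC ler_pdivrMr // mulrC.
by apply: le_trans (cs N NS); exact: le_support.
Qed.

(** * Integration on the sphere *)

Section SphereMeasure.
Variables (R : realType) (n : nat) (sigma : {measure set (BorelR R n) -> \bar R}).
Let S : set (BorelR R n) := sphere R n.

Lemma measurable_open (A : set 'rV[R]_(n.+1)) :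
  open A -> measurable (A : set (BorelR R n)).
Proof. by move=> oA; apply: sub_sigma_algebra. Qed.

Lemma measurable_sphere : measurable S.
Proof.
rewrite -(setCK S); apply: measurableC; apply: measurable_open.
exact/closed_openC/closed_sphere.
Qed.
Hint Resolve measurable_sphere : core.

Lemma measurable_ltfun (f g : 'rV[R]_(n.+1) -> R) : continuous f -> continuous g ->
  measurable ([set N | f N < g N] : set (BorelR R n)).
Proof. by move=> fc gc; apply: measurable_open; exact: open_ltfun. Qed.

Lemma within_continuous_measurable_fun (f : 'rV[R]_(n.+1) -> R) :
  {within sphere R n, continuous f} -> measurable_fun S f.
Proof.
move=> /continuousP cf; apply: (measurability _ (RGenOpens.measurableE R)).
move=> _ [_ [a [b ->] <-]].
have /open_subspaceP[V oV VS] := cf _ (@interval_open R (BRight a) (BLeft b) isT isT).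
have -> : S `&` f @^-1` `]a, b[%classic = V `&` S by rewrite VS setIC.
by apply: measurableI => //; exact: measurable_open.
Qed.

Hypothesis fin : (sigma S < +oo)%E.

Lemma bounded_integrable (f : 'rV[R]_(n.+1) -> R) M : measurable_fun S f ->
  (forall N, S N -> `|f N| <= M) -> sigma.-integrable S (EFin \o f).
Proof.
move=> mf fM; apply: measurable_bounded_integrable => //.
exists M; split; first exact: num_real.
by move=> y My N SN; apply: le_trans (fM N SN) _; exact: ltW.
Qed.

Lemma continuous_integrable (f : 'rV[R]_(n.+1) -> R) :
  {within sphere R n, continuous f} -> sigma.-integrable S (EFin \o f).
Proof.
move=> fc; apply: measurable_bounded_integrable => //.
  exact: within_continuous_measurable_fun.
have /compact_bounded[M [_ mrt]] := continuous_compact fc (@compact_sphere R n).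
by exists M; split; rewrite ?num_real // => ? ? ? ?; exact: mrt.
Qed.

Lemma cst_integrable c : sigma.-integrable S (EFin \o fun=> c).
Proof.
by apply: continuous_integrable; apply: continuous_subspaceT; exact: cst_continuous.
Qed.

Lemma integrable_add (f g : 'rV[R]_(n.+1) -> R) :
  sigma.-integrable S (EFin \o f) -> sigma.-integrable S (EFin \o g) ->
  sigma.-integrable S (EFin \o fun N => f N + g N).
Proof.
move=> fi gi; have -> : EFin \o (fun N => f N + g N) =
    ((EFin \o f : BorelR R n -> \bar R) \+ (EFin \o g))%E.
  by apply/funext => N; rewrite /= EFinD.
exact: integrableD.
Qed.

Definition sarea (A : set (BorelR R n)) : R := fine (sigma (S `&` A)).

Lemma sigma_sarea A : measurable A -> sigma (S `&` A) = (sarea A)%:E.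
Proof.
move=> mA; rewrite fineK // ge0_fin_numE //; apply: le_lt_trans fin.
by apply: le_measure; rewrite ?inE //; exact: measurableI.
Qed.

Lemma sarea_ge0 A : 0 <= sarea A. Proof. exact: fine_ge0. Qed.

Lemma sarea_disjoint_le A B C : measurable A -> measurable B -> measurable C ->
  (forall N, S N -> A N -> B N -> False) ->
  (forall N, S N -> A N -> C N) -> (forall N, S N -> B N -> C N) ->
  sarea A + sarea B <= sarea C.
Proof.
move=> mA mB mC AB AC BC; rewrite -lee_fin EFinD -!sigma_sarea // -measureU.
- apply: le_measure; rewrite ?inE.
  + by apply: measurableU; apply: measurableI.
  + exact: measurableI.
  by move=> N [[SN AN]|[SN BN]]; split => //; [exact: AC|exact: BC].
- exact: measurableI.
- exact: measurableI.
by apply/seteqP; split => N // -[[SN AN] [_ BN]]; exact: AB BN.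
Qed.

Lemma sarea_cover A B : measurable A -> measurable B ->
  (forall N, S N -> A N \/ B N) -> sarea setT <= sarea A + sarea B.
Proof.
move=> mA mB AB; rewrite -lee_fin EFinD -!sigma_sarea //.
apply: le_trans (measureU2 _ _ _); try exact: measurableI.
apply: le_measure; rewrite ?inE; first exact: measurableI.
- by apply: measurableU; apply: measurableI.
by move=> N [SN _]; have [AN|BN] := AB _ SN; [left|right].
Qed.

Lemma indic_integrable (A : set (BorelR R n)) c : measurable A ->
  sigma.-integrable S (EFin \o fun N => c * \1_A N).
Proof.
move=> mA; apply: (@bounded_integrable _ `|c|).
  by apply: measurable_funM => //; exact: measurable_indic.
move=> N _; rewrite normrM ler_piMr // indicE.
by case: (_ \in _); rewrite ?normr0 ?normr1.
Qed.

Lemma Rintegral_cindic (A : set (BorelR R n)) c : measurable A ->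
  \int[sigma]_(N in S) (c * \1_A N) = c * sarea A.
Proof.
move=> mA; rewrite RintegralZl //; last first.
  have := indic_integrable 1 mA; congr (integrable _ _ _).
  by apply/funext => N /=; rewrite mul1r.
by rewrite /Rintegral integral_indic // /sarea setIC.
Qed.

(** If [U] were null, its preimages under reflections would be null too, and finitely many of them
    would cover the sphere, whose mass is nonzero. *)
Lemma open_sarea_gt0 (U : set 'rV[R]_(n.+1)) N0 :
  standard_sphere_measure sigma -> sigma S != 0%E ->
  open U -> sphere R n N0 -> U N0 -> 0 < sarea U.
Proof.
move=> [sC _ sinv] s0 oU N0S UN0; rewrite lt_def sarea_ge0 andbT.
apply/eqP => U0; move/eqP: s0; apply.
have mU := measurable_open oU.
(* Invariance concerns whole preimages, so [U] itself must be null and not only its trace on the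
   sphere; the complement of the sphere carries no mass. *)
have sU : sigma U = 0%E.
  apply/eqP; rewrite eq_le measure_ge0 andbT.
  have -> : (0 = sigma (S `&` U) + sigma (~` S))%E by rewrite sigma_sarea // U0 sC adde0.
  apply: le_trans (measureU2 _ _ _); last 2 first.
  - exact: measurableI.
  - exact: measurableC.
  apply: le_measure; rewrite ?inE //.
  - by apply: measurableU; [exact: measurableI|exact: measurableC].
  by move=> N UN; have [SN|SN] := pselect (S N); [left|right].
(* The reflection exchanging [N0] and [v] puts [v] into [f v], so these open sets cover the
   sphere. *)
pose f v : set 'rV[R]_(n.+1) := reflection N0 v @^-1` U.
have fo v : open (f v).
  by apply: open_comp => // N _; exact: continuous_reflection.
have f0 v : sigma (f v) = 0%E.
  by rewrite sinv //; exact: dotp_reflection.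
have := @compact_sphere R n; rewrite compact_cover.
move=> /(_ _ (sphere R n) f (fun v _ => fo v)) [].
  by move=> v vS; exists v => //; rewrite /f /= reflectionE.
move=> D _; rewrite /cover bigcup_fset => SD.
have mD (s : seq 'rV[R]_(n.+1)) :
    measurable (\big[setU/set0]_(v <- s) f v : set (BorelR R n)).
  by elim/big_rec: _ => // v A _ mA; apply: measurableU => //; exact: measurable_open.
apply/eqP; rewrite eq_le measure_ge0 andbT.
have h : (sigma S <= sigma (\big[setU/set0]_(v <- finmap.enum_fset D) f v))%E.
  by apply: le_measure; rewrite ?inE.
apply: (le_trans h).
elim: (finmap.enum_fset D) {h SD} => [|v s IH]; first by rewrite big_nil measure0.
rewrite big_cons.
have h : (sigma (f v `|` \big[setU/set0]_(v <- s) f v)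
    <= sigma (f v) + sigma (\big[setU/set0]_(v <- s) f v))%E.
  by apply: measureU2; [exact: measurable_open|exact: mD].
by apply: (le_trans h); rewrite f0 add0e.
Qed.

End SphereMeasure.

(** * The functional in logarithmic coordinates *)

Section Functional.
Variables (R : realType) (n K : nat) (sigma : {measure set (BorelR R n) -> \bar R}).
Variables (x : 'I_K -> 'rV[R]_(n.+1)) (mu : 'I_K -> R).
Let S : set (BorelR R n) := sphere R n.
Implicit Types (s : 'I_K -> R) (N : 'rV[R]_(n.+1)) (A : {set 'I_K}).

(* In the logarithmic coordinates s = log p the functional p |-> Q[h_p, p], with
   h_p the least h such that (h, p) is admissible, is convex. *)
Definition logH s N : R := ln (Hmax x [set: 'I_K] (expR \o s) N).

Definition Phi s : R := \int[sigma]_(N in S) logH s N - \sum_i mu i * s i.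

Hypothesis xH : ~ (exists N, sphere R n N /\ forall i, 0 <= dotp (x i) N).
Hypothesis mu0 : forall i, 0 < mu i.
Hypothesis muS : (\sum_i mu i)%:E = sigma S.

Lemma sphere_fin : (sigma S < +oo)%E. Proof. by rewrite -muS ltry. Qed.

Lemma sarea_setT : sarea sigma setT = \sum_i mu i.
Proof. by rewrite /sarea setIT -/S -muS. Qed.

Lemma Hexp_gt0 s N : sphere R n N -> 0 < Hmax x [set: 'I_K] (expR \o s) N.
Proof. by apply: Hmax_gt0 => // i; exact: expR_gt0. Qed.

Lemma within_continuous_ln (h : 'rV[R]_(n.+1) -> R) :
  {within sphere R n, continuous h} -> (forall N, sphere R n N -> 0 < h N) ->
  {within sphere R n, continuous (fun N => ln (h N))}.
Proof.
move=> hc h0; apply: (@within_continuous_comp _ _ _ _ h (@ln R)) => // y.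
by rewrite inE => -[N NS <-]; apply: continuous_ln; exact: h0.
Qed.

Lemma logH_continuous s : {within sphere R n, continuous (logH s)}.
Proof.
apply: within_continuous_ln; last exact: Hexp_gt0.
exact/continuous_subspaceT/continuous_Hmax.
Qed.

Lemma logH_integrable s : sigma.-integrable S (EFin \o logH s).
Proof. by apply: continuous_integrable; [exact: sphere_fin|exact: logH_continuous]. Qed.

Lemma logH_le s s' c N : sphere R n N -> (forall i, s i <= c + s' i) ->
  logH s N <= c + logH s' N.
Proof.
move=> NS ss'.
have -> : c + logH s' N = ln (expR c * Hmax x [set: 'I_K] (expR \o s') N).
  by rewrite lnM ?posrE ?expR_gt0 ?Hexp_gt0 // expRK.
rewrite /logH ler_ln ?posrE ?mulr_gt0 ?expR_gt0 ?Hexp_gt0 //.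
apply: Hmax_scale_le => [|i|i _]; rewrite ?expR_ge0 ?expR_gt0 //=.
by rewrite -expRD ler_expR.
Qed.

Lemma logH_ge s N i : 0 < dotp (x i) N -> s i + ln (dotp (x i) N) <= logH s N.
Proof.
move=> d0.
have -> : s i + ln (dotp (x i) N) = ln (expR (s i) * dotp (x i) N).
  by rewrite lnM ?posrE ?expR_gt0 // expRK.
have pd : 0 < expR (s i) * dotp (x i) N by rewrite mulr_gt0 ?expR_gt0.
have dH : expR (s i) * dotp (x i) N <= Hmax x [set: 'I_K] (expR \o s) N.
  by apply: (@Hmax_ge _ _ _ x _ (expR \o s)).
by rewrite /logH ler_ln ?posrE //; exact: lt_le_trans dH.
Qed.

Lemma integral_cst_add c s :
  \int[sigma]_(N in S) (c + logH s N) =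
  c * (\sum_i mu i) + \int[sigma]_(N in S) logH s N.
Proof.
have mS : measurable S by exact: measurable_sphere.
rewrite RintegralD //.
- by rewrite Rintegral_cst // -/S -muS.
- by apply: cst_integrable; exact: sphere_fin.
- exact: logH_integrable.
Qed.

Lemma add_logH_integrable c s : sigma.-integrable S (EFin \o fun N => c + logH s N).
Proof.
apply: continuous_integrable; first exact: sphere_fin.
apply: (@within_continuousD _ _ _ _ (fun=> c)); last exact: logH_continuous.
by apply: continuous_subspaceT; exact: cst_continuous.
Qed.

Lemma integral_logH_le s s' c : (forall i, s i <= c + s' i) ->
  \int[sigma]_(N in S) logH s N <=
  c * (\sum_i mu i) + \int[sigma]_(N in S) logH s' N.
Proof.
move=> ss'; rewrite -integral_cst_add; apply: le_Rintegral.
- exact: measurable_sphere.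
- exact: logH_integrable.
- exact: add_logH_integrable.
by move=> N NS; exact: logH_le.
Qed.

(** The shift adds c sigma(S) to the integral and c times the sum of the [mu i] to the linear part;
    by [muS] these cancel. *)
Lemma Phi_shift s c : Phi (fun i => s i + c) = Phi s.
Proof.
rewrite /Phi; have -> : \int[sigma]_(N in S) logH (fun i => s i + c) N =
    c * (\sum_i mu i) + \int[sigma]_(N in S) logH s N.
  apply/eqP; rewrite eq_le integral_logH_le /=; last by move=> i; rewrite addrC.
  have h : \int[sigma]_(N in S) logH s N <=
      - c * (\sum_i mu i) + \int[sigma]_(N in S) logH (fun i => s i + c) N.
    by apply: integral_logH_le => i; lra.
  by rewrite mulNr addrC lerBrDr addrC in h.
have -> : \sum_i mu i * (s i + c) = \sum_i mu i * s i + (\sum_i mu i) * c.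
  by rewrite mulr_suml -big_split; apply: eq_bigr => i _; rewrite mulrDr.
by ring.
Qed.

(** The integral and the linear part each move by at most d times the total mass, whence the factor
    2. *)
Lemma Phi_lipschitz s s' d : (forall i, `|s i - s' i| <= d) ->
  Phi s <= Phi s' + 2 * d * (\sum_i mu i).
Proof.
move=> ss'; have ss1 i : s i <= d + s' i by have := ss' i; rewrite ler_norml; lra.
have : \sum_i mu i * s' i <= d * (\sum_i mu i) + \sum_i mu i * s i.
  rewrite mulr_sumr -big_split /=; apply: ler_sum => i _.
  by have := ss' i; rewrite ler_norml => /andP[? ?]; have := mu0 i; nra.
have := integral_logH_le ss1; rewrite /Phi.
by move: (Rintegral _ _ _) (Rintegral _ _ _) => u v; lra.
Qed.

Lemma Phi_continuous (T : topologicalType) (f : 'I_K -> T -> R) :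
  (forall i, continuous (f i)) -> continuous (fun v => Phi (fun i => f i v)).
Proof.
move=> fc v; set m := \sum_i mu i.
have m0 : 0 <= m by apply: sumr_ge0 => i _; exact: ltW.
apply/cvgrPdist_le => e e0.
(* The Lipschitz bound 2 d m stays below e for this d; the added 1 keeps the denominator
   positive. *)
have d0 : 0 < e / (2 * m + 1) by rewrite divr_gt0 // ltr_wpDl // mulr_ge0.
have : \forall w \near v, forall i, `|f i v - f i w| <= e / (2 * m + 1).
  apply: filter_forall => i.
  have /cvgrPdist_le := fc i v.
  exact.
apply: filterS => w vw; have dm : 2 * (e / (2 * m + 1)) * m <= e.
  rewrite mulrAC -[leRHS](@divfK _ (2 * m + 1)); last first.
    by rewrite gt_eqF // ltr_wpDl // mulr_ge0.
  by rewrite mulrC ler_wpM2l //; [exact: ltW|lra].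
have vw1 := @Phi_lipschitz (fun i => f i v) (fun i => f i w) _ vw.
have vw2 := @Phi_lipschitz (fun i => f i w) (fun i => f i v) (e / (2 * m + 1)).
have {}vw2 := vw2 (fun i => eq_ind _ (fun a => a <= _) (vw i) _ (distrC _ _)).
by rewrite ler_norml -/m in vw1 vw2 *; apply/andP; split; lra.
Qed.

(** Admissibility says that [h] dominates each form p_i <x_i, .> where the form is positive, and h >
    0 settles the rest. Hence [h] is at least the maximum of the forms. *)
Lemma admissible_QK (h : 'rV[R]_(n.+1) -> R) (p : 'I_K -> R) :
  admissible x h p ->
  QK sigma mu h p =
    (\int[sigma]_(N in S) ln (h N) - \sum_i mu i * ln (p i))%:E /\
  Phi (fun i => ln (p i)) <= \int[sigma]_(N in S) ln (h N) - \sum_i mu i * ln (p i).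
Proof.
move=> [hc h0 p0 hp].
have hi : sigma.-integrable S (EFin \o fun N => ln (h N)).
  by apply: continuous_integrable; [exact: sphere_fin|exact: within_continuous_ln].
split.
  rewrite /QK EFinB /Rintegral fineK //.
  by apply: integrable_fin_num => //; exact: measurable_sphere.
rewrite /Phi lerB //; apply: le_Rintegral => //.
- exact: measurable_sphere.
- exact: logH_integrable.
move=> N NS; rewrite /logH ler_ln ?posrE ?Hexp_gt0 ?h0 //.
apply: Hmax_le => [|i _]; first exact/ltW/h0.
have [d0|d0] := leP (dotp (x i) N) 0.
  by apply: (@le_trans _ _ 0); [rewrite mulr_ge0_le0 ?expR_ge0|exact/ltW/h0].
rewrite /= lnK ?posrE //; have := hp i N NS d0.
by rewrite lerBrDr addrC -lnM ?posrE // ler_ln ?posrE ?mulr_gt0 ?h0.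
Qed.

End Functional.

(** * Coercivity and existence of a minimizer *)

Section Coercivity.
Variables (R : realType) (n K : nat) (sigma : {measure set (BorelR R n) -> \bar R}).
Variables (x : 'I_K -> 'rV[R]_(n.+1)) (mu : 'I_K -> R).
Let S : set (BorelR R n) := sphere R n.
Implicit Types (s : 'I_K -> R) (N : 'rV[R]_(n.+1)) (I : {set 'I_K}).

Hypothesis xS : forall i, sphere R n (x i).
Hypothesis xH : ~ (exists N, sphere R n N /\ forall i, 0 <= dotp (x i) N).
Hypothesis mu0 : forall i, 0 < mu i.
Hypothesis muS : (\sum_i mu i)%:E = sigma S.
Hypothesis cone : forall V : set 'rV[R]_(n.+1), polyhedral_cone V -> V <> setT ->
  ((\sum_(i | x i \notin V) mu i)%:E > sigma (polar_set (sphere R n `&` V)))%E.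

(** For d >= 0 this meets the sphere in the union of the open spherical caps around the [x i] with i
    in [I], see [capP]. *)
Definition cap I (d : R) : set (BorelR R n) := [set N | d < Hmax x I (fun=> 1) N].

Lemma measurable_cap I d : measurable (cap I d).
Proof. by apply: measurable_ltfun; [exact: cst_continuous|exact: continuous_Hmax]. Qed.

Lemma capP I d N : 0 <= d -> cap I d N <-> exists2 i, i \in I & d < dotp (x i) N.
Proof.
move=> d0; split => [dH|[i iI di]]; last first.
  apply: lt_le_trans di _; rewrite -[leLHS]mul1r.
  exact: (@Hmax_ge _ _ _ x I (fun=> 1)).
apply: contrapT => nx; move: dH; rewrite /cap /= ltNge => /negP; apply.
apply: Hmax_le => // i iI; rewrite mul1r leNgt; apply/negP => di.
by apply: nx; exists i.
Qed.

Let fin := sphere_fin muS.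
Hint Resolve measurable_cap : core.
Hint Resolve fin : core.

(** The part of the sphere outside the caps is the polar set of the cone spanned by the [x i] with i
    in [I], and a point [x i] outside that cone has its index outside [I]. *)
Lemma sarea_capC_lt I : I != finset.set0 -> ~: I != finset.set0 ->
  sarea sigma (~` cap I 0) < \sum_(i in ~: I) mu i.
Proof.
move=> I0 IT; have m0 : (0 < #|I|)%N by rewrite card_gt0.
(* [polyhedral_cone] indexes its generators by an ordinal of successor form; [I] is nonempty. *)
pose v (j : 'I_(#|I|.-1.+1)) := x (enum_val (cast_ord (prednK m0) j)).
pose V := [set y | exists c : 'I_(#|I|.-1.+1) -> R,
   (forall j, 0 <= c j) /\ y = \sum_j c j *: v j].
have Vcone : polyhedral_cone V.
  by exists #|I|.-1, v; split => // j; apply: sphere_neq0; exact: xS.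
have xV i : i \in I -> V (x i).
  move=> iI; pose j0 := cast_ord (esym (prednK m0)) (enum_rank_in iI i).
  have vj0 : v j0 = x i by rewrite /v cast_ordKV enum_rankK_in.
  exists (fun j => (j == j0)%:R); split => //.
  rewrite (bigD1 j0) //= eqxx scale1r vj0 big1 ?addr0 // => j /negbTE ->.
  by rewrite scale0r.
have polarE : polar_set (sphere R n `&` V) = S `&` ~` cap I 0.
  apply/seteqP; split => N [NS NV]; split => //.
    move=> /capP[//|i iI]; apply/negP; rewrite -leNgt.
    by apply: NV; split => //; exact: xV.
  move=> y [_ [c [c0 ->]]]; rewrite dotp_suml; apply: sumr_le0 => j _.
  rewrite dotpZl mulr_ge0_le0 // leNgt; apply/negP => d0; apply: NV.
  apply/capP => //; exists (enum_val (cast_ord (prednK m0) j)) => //.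
  exact: enum_valP.
(* The cone may be the whole space even when [I] is proper; its polar set is then empty, and the
   positive mass outside [I] suffices. *)
have [VT|VT] := pselect (V = setT).
  have -> : sarea sigma (~` cap I 0) = 0.
    rewrite /sarea -/S -polarE VT setIT (_ : polar_set _ = set0) ?measure0 //.
    apply/seteqP; split => N // -[NS NN].
    by have := NN N NS; rewrite (NS : dotp N N = 1) ler10.
  have /set0Pn[j jI] := IT.
  by rewrite (bigD1 j) //= ltr_wpDr // sumr_ge0 // => i _; exact: ltW.
have := cone Vcone VT; rewrite polarE sigma_sarea //; last exact: measurableC.
rewrite lte_fin => /lt_le_trans; apply.
rewrite [leRHS](bigID (fun i => x i \notin V)) /=.
rewrite (eq_bigl (fun i => (i \in ~: I) && (x i \notin V))) => [|i].
  by rewrite lerDl sumr_ge0 // => i _; exact: ltW.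
rewrite inE; have [iI|//] := boolP (i \in I).
by apply/negP; rewrite inE => /(_ (xV i iI)).
Qed.

Lemma sarea_cap_gt I : I != finset.set0 -> ~: I != finset.set0 ->
  \sum_(i in I) mu i < sarea sigma (cap I 0).
Proof.
move=> I0 IT; have Cle := sarea_capC_lt I0 IT.
have : sarea sigma setT <= sarea sigma (cap I 0) + sarea sigma (~` cap I 0).
  apply: sarea_cover => //; first exact: measurableC.
  by move=> N _; exact: lem.
rewrite (sarea_setT muS) (bigID (mem I)) /=.
have -> : \sum_(i | i \notin I) mu i = \sum_(i in ~: I) mu i.
  by apply: eq_bigl => i; rewrite inE.
by lra.
Qed.

(** As k grows, the caps of level 1/(k+1) increase to those of level 0, so by continuity from below
    they keep the strict inequality of [sarea_cap_gt]. *)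
Lemma cap_near I : I != finset.set0 -> ~: I != finset.set0 ->
  \forall k \near \oo, \sum_(i in I) mu i + k.+1%:R^-1 <= sarea sigma (cap I k.+1%:R^-1).
Proof.
move=> I0 IT; have lt := sarea_cap_gt I0 IT; set a := \sum_(i in I) mu i in lt *.
set b := sarea sigma (cap I 0) in lt.
pose F k := S `&` cap I k.+1%:R^-1.
have mF k : measurable (F k) by apply: measurableI => //; exact: measurable_sphere.
have FU : \bigcup_k F k = S `&` cap I 0.
  apply/seteqP; split => N.
    by move=> [k _ [SN Nk]]; split => //; apply: le_lt_trans Nk; rewrite invr_ge0.
  move=> [SN N0]; have [k _ kN] := @near_infty_natSinv_lt R (PosNum N0).
  by exists k => //; split => //; apply: kN => /=.
have : (sigma \o F) k @[k --> \oo] --> sigma (\bigcup_k F k).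
  apply: nondecreasing_cvg_mu => //.
    by rewrite FU; apply: measurableI => //; exact: measurable_sphere.
  move=> j k jk; apply/subsetPset => N [SN Nj]; split => //.
  by apply: le_lt_trans Nj; rewrite lef_pV2 ?posrE // ler_nat.
rewrite FU sigma_sarea // -/b => /fine_cvgP[_ /cvgr_gt Fb].
(* Half of the gap b - a goes to the limit, the other half to the summand 1/(k+1). *)
have {}Fb := Fb ((a + b) / 2) ltac:(lra).
have ab0 : 0 < (b - a) / 2 by lra.
have kab := @near_infty_natSinv_lt R (PosNum ab0).
near=> k; have h1 : (a + b) / 2 < sarea sigma (cap I k.+1%:R^-1) by near: k.
have h2 : k.+1%:R^-1 < (b - a) / 2 by near: k.
apply/ltW; apply: lt_trans h1; rewrite -ltrBrDl; apply: lt_le_trans h2 _.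
by rewrite (_ : (b - a) / 2 = (a + b) / 2 - a) //; field.
Unshelve. all: by end_near. Qed.

(** There are finitely many index sets, so one level works for all of them. It is also taken below
    the positive minimum of the maximum of the forms, which gives the second property. *)
Lemma ex_uniform_gap : exists d : R, [/\ 0 < d,
  forall N, sphere R n N -> exists i, d < dotp (x i) N &
  forall I, I != finset.set0 -> ~: I != finset.set0 ->
    \sum_(i in I) mu i + d <= sarea sigma (cap I d)].
Proof.
have [c c0 cH] := Hmax_lbound xH (fun=> ltr01 : (0:R) < 1).
have : \forall k \near \oo, forall I, I != finset.set0 -> ~: I != finset.set0 ->
    \sum_(i in I) mu i + k.+1%:R^-1 <= sarea sigma (cap I k.+1%:R^-1).
  apply: filter_forall => I; have [I0|I0] := boolP (I != finset.set0); last exact: nearW.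
  have [IT|IT] := boolP (~: I != finset.set0); last by apply: nearW => k _.
  by apply: filterS (cap_near I0 IT).
move=> capk; have kc := @near_infty_natSinv_lt R (PosNum c0).
have [k [k1 k2]] : exists k, (forall I, I != finset.set0 -> ~: I != finset.set0 ->
    \sum_(i in I) mu i + k.+1%:R^-1 <= sarea sigma (cap I k.+1%:R^-1)) /\
    k.+1%:R^-1 < c.
  have /filter_ex[k [k1 k2]] : \oo (
    (fun k : nat => forall I, I != finset.set0 -> ~: I != finset.set0 ->
      \sum_(i in I) mu i + k.+1%:R^-1 <= sarea sigma (cap I k.+1%:R^-1)) `&`
    (fun k => k.+1%:R^-1 < c)) by apply: filterI.
  by exists k.
exists k.+1%:R^-1; split; [by rewrite invr_gt0|move=> N NS|exact: k1].
have k0 : 0 <= k.+1%:R^-1 :> R by rewrite invr_ge0.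
have : cap [set: 'I_K] k.+1%:R^-1 N by apply: lt_le_trans k2 _; exact: cH.
by move=> /(capP _ _ k0)[i _ di]; exists i.
Qed.

End Coercivity.

Section Minimizer.
Variables (R : realType) (n K : nat) (sigma : {measure set (BorelR R n) -> \bar R}).
Variables (x : 'I_K -> 'rV[R]_(n.+1)) (mu : 'I_K -> R).
Let S : set (BorelR R n) := sphere R n.
Implicit Types (s : 'I_K -> R) (N : 'rV[R]_(n.+1)) (I : {set 'I_K}).

Hypothesis xS : forall i, sphere R n (x i).
Hypothesis xH : ~ (exists N, sphere R n N /\ forall i, 0 <= dotp (x i) N).
Hypothesis mu0 : forall i, 0 < mu i.
Hypothesis muS : (\sum_i mu i)%:E = sigma S.

Let fin := sphere_fin muS.

Section Gap.
Variable d : R.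
Hypothesis d0 : 0 < d.
Hypothesis dx : forall N, sphere R n N -> exists i, d < dotp (x i) N.
Hypothesis dgap : forall I, I != finset.set0 -> ~: I != finset.set0 ->
  \sum_(i in I) mu i + d <= sarea sigma (cap x I d).

(* A layer-cake estimate, by lowering the top level of s to the next one; each
   unit of lowering gains at least d because of dgap. *)
Lemma ex_minorant s : exists g : 'rV[R]_(n.+1) -> R,
  [/\ sigma.-integrable S (EFin \o g),
      forall N, sphere R n N -> exists2 i, d < dotp (x i) N & g N <= s i &
      forall i k, d * (s i - s k) <= \int[sigma]_(N in S) g N - \sum_i mu i * s i].
Proof.
(* Induction on the number of indices strictly below the top level of [s]. *)
have [m] := ubnP #|[set i | [exists j, s i < s j]]%SET|; elim: m s => // m IH s.
set B := [set i | _]%SET; rewrite ltnS => Bm.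
have [M MS] := sphere_nonempty R n; have [i00 _] := dx MS.
have BP i : reflect (exists j, s i < s j) (i \in B).
  by rewrite inE; apply: existsP.
have notB i j : i \notin B -> s j <= s i.
  by move=> iB; rewrite leNgt; apply: contra iB => ij; apply/BP; exists j.
(* With no index below the top, [s] is constant, and both sides of the bound vanish for the constant
   function. *)
have [B0|[j0 j0B]] := set_0Vmem B.
  have sc i : s i = s i00.
    have nB k : k \notin B by rewrite B0 finset.inE.
    by apply/eqP; rewrite eq_le !notB.
  exists (fun=> s i00); split.
  - exact: cst_integrable.
  - by move=> N /dx[i di]; exists i; rewrite ?sc.
  move=> i k; rewrite !sc subrr mulr0 Rintegral_cst //; last exact: measurable_sphere.
  under eq_bigr do rewrite sc.
  by rewrite -mulr_suml -/S -muS /= mulrC subrr.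
have [j jB' jmax'] := @arg_maxP _ _ _ j0 (mem B) s j0B; have jB : j \in B by [].
have jmax i : i \in B -> s i <= s j by exact: jmax'.
have [i0 _ i0max'] := @arg_maxP _ _ _ i00 predT s isT.
have i0max i : s i <= s i0 by exact: i0max'.
have i0B : i0 \notin B.
  by apply/BP => -[k]; rewrite ltNge i0max.
have sM i : i \notin B -> s i = s i0.
  by move=> iB; apply/eqP; rewrite eq_le !notB.
have jM : s j < s i0.
  by have /BP[k jk] := jB; apply: lt_le_trans jk _; exact: i0max.
(* [s j] is the second highest level; [s'] flattens the top level down to it. *)
pose s' i := if i \in B then s i else s j.
have s'j i : s' i <= s j by rewrite /s'; case: ifPn => // /jmax.
have s's i : s' i <= s i by rewrite /s'; case: ifPn => // iB; exact: notB.
have [|g [gi gle gap]] := IH s'.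
  apply: leq_trans Bm; apply: proper_card; apply/fintype.properP; split.
    apply/fintype.subsetP => i; rewrite inE => /existsP[k ik].
    have : s' i < s j by apply: lt_le_trans ik _.
    by rewrite {1}/s'; case: ifPn => // _; rewrite ltxx.
  exists j => //; rewrite inE; apply/existsP => -[k].
  by rewrite {1}/s' jB ltNge s'j.
pose w := s i0 - s j; have w0 : 0 < w by rewrite subr_gt0.
have mC : measurable (cap x (~: B) d) by exact: measurable_cap.
have wi := indic_integrable fin w mC.
(* The drop w is restored exactly where some top-level index has its form above d; that index then
   witnesses the pointwise bound. *)
exists (fun N => g N + w * \1_(cap x (~: B) d) N); split.
- exact: (integrable_add gi wi).
- move=> N NS; have [i di gi'] := gle N NS.
  rewrite indicE; have [NC|NC] := boolP (N \in _); last first.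
    by exists i => //; rewrite mulr0 addr0; apply: le_trans gi' _.
  move: NC; rewrite inE => /(capP _ _ _ (ltW d0))[k kB dk].
  exists k => //; rewrite inE in kB; rewrite (sM _ kB) mulr1 /w.
  by have := s'j i; lra.
move=> i k; rewrite RintegralD //; last exact: measurable_sphere.
rewrite (Rintegral_cindic fin) //.
have -> : \sum_i mu i * s i = \sum_i mu i * s' i + (\sum_(i in ~: B) mu i) * w.
  rewrite mulr_suml [X in _ + X]big_mkcond -big_split /=.
  apply: eq_bigr => l _; rewrite inE /s'; case: ifPn => [_|lB] /=; first by rewrite addr0.
  by rewrite (sM _ lB) /w; ring.
have B1 : ~: B != finset.set0 by apply/set0Pn; exists i0; rewrite inE.
have B2 : ~: ~: B != finset.set0 by rewrite finset.setCK; apply/set0Pn; exists j.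
(* Restoring w gains at least w d. Since [j] is on the top level of [s'], the inductive bound for
   [j] and [k] plus w d covers d (s i - s k). *)
have wg := ler_wpM2l (ltW w0) (dgap B1 B2).
have gk := gap j k.
have sk : d * (s i - s k) <= d * (s' j - s' k) + w * d.
  rewrite (mulrC w) -mulrDr ler_wpM2l ?(ltW d0) // /w /s' jB.
  have := i0max i; case: ifPn => [_|kB]; first by lra.
  by rewrite (sM _ kB); lra.
by lra.
Qed.

(** The index that bounds g N from above has <x_i, N> > d, so the logarithm of the maximum is at
    least g N + ln d. *)
Lemma Phi_coercive s i k :
  d * (s i - s k) + ln d * (\sum_i mu i) <= Phi sigma x mu s.
Proof.
have [g [gi gle gap]] := ex_minorant s.
have dc : sigma.-integrable S (EFin \o fun=> ln d) by exact: cst_integrable.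
have : \int[sigma]_(N in S) (g N + ln d) <= \int[sigma]_(N in S) logH x s N.
  apply: le_Rintegral.
  - exact: measurable_sphere.
  - exact: (integrable_add gi dc).
  - exact: (logH_integrable xH muS).
  move=> N NS; have [l dl gl] := gle N NS.
  apply: le_trans (logH_ge s (lt_trans d0 dl)).
  by apply: lerD => //; rewrite ler_ln ?posrE ?(lt_trans d0 dl) // ltW.
rewrite RintegralD //; last exact: measurable_sphere.
rewrite Rintegral_cst -/S -?muS /=; last exact: measurable_sphere.
have := gap i k; rewrite /Phi.
by move: (Rintegral _ _ _) (Rintegral _ _ _) => u v; lra.
Qed.

(** Shift invariance normalizes one coordinate to 0; linear growth then confines the search to a
    compact box. *)
Lemma ex_minimizer : exists s, forall s', Phi sigma x mu s <= Phi sigma x mu s'.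
Proof.
have [M MS] := sphere_nonempty R n; have [i0 _] := dx MS.
(* At spread b the lower bound of [Phi_coercive] already reaches the value of [Phi] at 0. *)
pose b := `|Phi sigma x mu (fun=> 0) - ln d * (\sum_i mu i)| / d.
have b0 : 0 <= b by rewrite divr_ge0 // ltW.
pose F (v : 'rV[R]_K) := Phi sigma x mu (fun i => v ord0 i).
pose D := [set v : 'rV[R]_K | forall i, `[- b, b]%classic (v ord0 i)].
have Fc : continuous F.
  by apply: (Phi_continuous xH mu0 muS) => i; exact: coord_continuous.
have D0 : D 0 by move=> i /=; rewrite mxE in_itv /= oppr_le0 b0.
have [|||v vD vmin] := @EVT_min_rV _ _ F D.
- by exists 0.
- exact: compact_box.
- exact: continuous_subspaceT.
have F0 : F 0 = Phi sigma x mu (fun=> 0).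
  by congr Phi; apply/funext => i; rewrite mxE.
exists (fun i => v ord0 i) => s'; rewrite -/(F v).
rewrite -(Phi_shift xH muS s' (- s' i0)); set t := fun i => _.
have [tb|/existsNP[i /negP ti]] := pselect (forall i, `|t i| <= b).
  have -> : Phi sigma x mu t = F (\row_i t i).
    by congr Phi; apply/funext => i; rewrite mxE.
  by apply: vmin; rewrite inE => i /=; rewrite mxE in_itv /= -ler_norml.
apply: (@le_trans _ _ (F 0)); first by apply: vmin; rewrite inE.
have t0 : t i0 = 0 by rewrite /t subrr.
have bd : Phi sigma x mu (fun=> 0) - ln d * (\sum_i mu i) <= d * b.
  by rewrite /b [leRHS]mulrC divfK ?gt_eqF // ler_norm.
rewrite F0; move: ti; rewrite -ltNge => /ltW/(ler_wpM2l (ltW d0)).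
have [ti0|ti0] := leP 0 (t i).
  by have := Phi_coercive t i i0; rewrite t0 subr0 ger0_norm //; lra.
by have := Phi_coercive t i0 i; rewrite t0 sub0r ltr0_norm //; lra.
Qed.

End Gap.
End Minimizer.

(** * Uniqueness of the minimizer *)

(** The segment between non-antipodal points avoids O, and homogeneity carries a zero on it to the
    sphere. *)
Lemma sphere_IVT (R : realType) (n : nat) (f : 'rV[R]_(n.+1) -> R) N1 N2 :
  continuous f -> (forall c N, 0 <= c -> f (c *: N) = c * f N) ->
  sphere R n N1 -> sphere R n N2 -> N2 <> - N1 -> f N1 <= 0 -> 0 <= f N2 ->
  exists2 N, sphere R n N & f N = 0.
Proof.
move=> fc fh N1S N2S N12 f1 f2.
pose g (r : R) := (1 - r) *: N1 + r *: N2.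
have gc : continuous g.
  move=> r; apply: cvgD; apply: cvgZ; try by apply: cvg_cst.
    by apply: cvgB; [apply: cvg_cst|apply: cvg_id].
  by apply: cvg_id.
have [||r] := @IVT R (f \o g) 0 1 0 ler01.
- apply: continuous_subspaceT => r; apply: continuous_comp; [exact: gc|exact: fc].
- rewrite /= /g subr0 subrr !scale0r !scale1r addr0 add0r.
  by rewrite ge_min f1 /= le_max f2 orbT.
rewrite in_itv /= => /andP[r0 r1] fg0.
have g0 : g r != 0.
  apply/eqP => gr0; have rN : r *: N2 = (1 - r) *: (- N1).
    by apply/eqP; rewrite scalerN -addr_eq0 addrC; apply/eqP.
  have {}r0 : 0 < r.
    rewrite lt_def r0 andbT; apply/eqP => r00; have := sphere_neq0 N1S.
    by move: gr0; rewrite /g r00 subr0 scale1r scale0r addr0 => ->; rewrite eqxx.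
  have {}r1 : r < 1.
    rewrite lt_def r1 andbT; apply/eqP => r11; have := sphere_neq0 N2S.
    by move: gr0; rewrite /g -r11 subrr scale1r scale0r add0r => ->; rewrite eqxx.
  apply: N12; apply: (@sphere_scale_eq _ _ (r^-1 * (1 - r))) => //.
  - by rewrite mulr_gt0 ?invr_gt0 // subr_gt0.
  - exact: sphereN.
  by rewrite -scalerA -rN scalerA mulVf ?scale1r // gt_eqF.
exists ((Num.sqrt (dotp (g r) (g r)))^-1 *: g r); first exact: normalize_sphere.
by rewrite fh ?invr_ge0 ?sqrtr_ge0 // fg0 mulr0.
Qed.

Section Uniqueness.
Variables (R : realType) (n K : nat) (sigma : {measure set (BorelR R n) -> \bar R}).
Variables (x : 'I_K -> 'rV[R]_(n.+1)) (mu : 'I_K -> R).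
Let S : set (BorelR R n) := sphere R n.
Implicit Types (s : 'I_K -> R) (N : 'rV[R]_(n.+1)) (I : {set 'I_K}).

Hypothesis xS : forall i, sphere R n (x i).
Hypothesis xH : ~ (exists N, sphere R n N /\ forall i, 0 <= dotp (x i) N).
Hypothesis mu0 : forall i, 0 < mu i.
Hypothesis muS : (\sum_i mu i)%:E = sigma S.
Let fin := sphere_fin muS.

Local Notation H I s := (Hmax x I (expR \o s)).

(** First variation: raising [s] by a on [I] increases the log-maximum by at most a on this set and
    not at all elsewhere on the sphere, while the linear part rises by a mu(I). *)
Lemma minimizer_sarea_ge s I a : (forall s', Phi sigma x mu s <= Phi sigma x mu s') ->
  0 < a -> \sum_(i in I) mu i <= sarea sigma [set N | H (~: I) s N < expR a * H I s N].
Proof.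
move=> smin a0; set A := [set N | _].
have mA : measurable (A : set (BorelR R n)).
  apply: measurable_ltfun; first exact: continuous_Hmax.
  by apply: continuous_mul; [exact: cst_continuous|exact: continuous_Hmax].
pose s' i := if i \in I then s i + a else s i.
have ai := indic_integrable fin a mA.
have si := logH_integrable xH muS.
have : \int[sigma]_(N in S) logH x s' N <=
    \int[sigma]_(N in S) (logH x s N + a * \1_A N).
  apply: le_Rintegral => //.
  - exact: measurable_sphere.
  - exact: integrable_add.
  move=> N NS; rewrite indicE; have [NA|NA] := boolP (N \in _).
    rewrite mulr1 addrC; apply: logH_le => // i.
    by rewrite /s'; case: ifP => _; lra.
  rewrite mulr0 addr0 /logH ler_ln ?posrE ?Hexp_gt0 //.
  move: NA; rewrite notin_setE /A /= => /negP; rewrite -leNgt => NA.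
  (* Outside [A] the raised forms of [I] still do not exceed the maximum over the complement. *)
  apply: le_trans (Hmax_setC x I _ N) _; rewrite ge_max; apply/andP; split.
    have -> : H I s' N = expR a * H I s N.
      apply: Hmax_scale => [|i|i|i iI] /=; rewrite ?expR_gt0 //.
      by rewrite /s' iI addrC expRD.
    by apply: le_trans NA _; apply: Hmax_sub; apply/fintype.subsetP.
  apply: (@le_trans _ _ (1 * H (~: I) s N)); last first.
    by rewrite mul1r; apply: Hmax_sub; apply/fintype.subsetP.
  apply: Hmax_scale_le => // [i|i]; rewrite /= ?expR_gt0 // inE mul1r /s'.
  by move=> /negbTE ->.
rewrite RintegralD //; last exact: measurable_sphere.
rewrite (Rintegral_cindic fin) // => le1.
have := smin s'; rewrite /Phi.
have -> : \sum_i mu i * s' i = \sum_i mu i * s i + a * (\sum_(i in I) mu i).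
  rewrite mulr_sumr [X in _ + X]big_mkcond -big_split /=.
  by apply: eq_bigr => i _; rewrite /s'; case: ifP => _; ring.
move=> le2; rewrite -(ler_pM2l a0); move: le1 le2.
by move: (Rintegral _ _ _) (Rintegral _ _ _) => u v; lra.
Qed.

Lemma sarea_gt0_nonempty A : 0 < sarea sigma A -> exists2 N, sphere R n N & A N.
Proof.
move=> A0; apply: contrapT => nA; move: A0; rewrite /sarea.
rewrite (_ : _ `&` A = set0) ?measure0 ?ltxx //.
by apply/seteqP; split => N // -[NS AN]; apply: nA; exists N.
Qed.

Hypothesis cone : forall V : set 'rV[R]_(n.+1), polyhedral_cone V -> V <> setT ->
  ((\sum_(i | x i \notin V) mu i)%:E > sigma (polar_set (sphere R n `&` V)))%E.

(** This is the cone hypothesis for the ray through [N], whose polar set is the opposite closed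
    hemisphere. *)
Lemma hemisphere_sarea_lt N : sphere R n N ->
  sarea sigma (~` [set y | 0 < dotp N y]) < \sum_(i | x i != N) mu i.
Proof.
move=> NS; pose V := [set y | exists c : 'I_1 -> R,
   (forall j, 0 <= c j) /\ y = \sum_j c j *: N].
have Vcone : polyhedral_cone V.
  by exists 0%N, (fun=> N); split => // j; exact: sphere_neq0.
have VN : V N by exists (fun=> 1); rewrite big_ord1 scale1r.
have VT : V <> setT.
  move=> VT; have [c [c0]] : V (- N) by rewrite VT.
  rewrite big_ord1 => /(congr1 (dotp N)); rewrite dotpNr dotpZr (NS : dotp N N = 1).
  by have := c0 ord0; lra.
have mN : measurable ([set y | 0 < dotp N y] : set (BorelR R n)).
  by apply: measurable_ltfun; [exact: cst_continuous|exact: dotp_continuousr].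
have polarE : polar_set (sphere R n `&` V) = S `&` ~` [set y | 0 < dotp N y].
  apply/seteqP; split => y [yS yV]; split => //.
    by apply/negP; rewrite -leNgt; apply: yV.
  move=> _ [_ [c [c0 ->]]]; rewrite big_ord1 dotpZl mulr_ge0_le0 // leNgt.
  exact/negP.
have := cone Vcone VT; rewrite polarE sigma_sarea //; last exact: measurableC.
rewrite lte_fin => /lt_le_trans; apply.
rewrite [leRHS](bigID (fun i => x i \notin V)) /=.
rewrite (eq_bigl (fun i => (x i != N) && (x i \notin V))) => [|i].
  by rewrite lerDl sumr_ge0 // => i _; exact: ltW.
have [->|//] := eqVneq (x i) N.
by apply/negP; rewrite inE => /(_ VN).
Qed.

(** If every [x i] were N or -N, the strict bounds for two opposite closed hemispheres, which cover
    the sphere, would add up to less than the total mass. *)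
Lemma ex_third_point N : sphere R n N -> exists i, x i <> N /\ x i <> - N.
Proof.
move=> NS; apply: contrapT => nx.
have xN i : x i != N -> x i = - N.
  move=> /eqP iN; apply: contrapT => iN'; apply: nx; by exists i.
have mN M : measurable ([set y | 0 < dotp M y] : set (BorelR R n)).
  by apply: measurable_ltfun; [exact: cst_continuous|exact: dotp_continuousr].
have := sarea_cover fin (measurableC (mN N)) (measurableC (mN (- N))).
rewrite (sarea_setT muS) => /(_ _)/wrap[].
  move=> y _; have [y0|y0] := leP (dotp N y) 0.
    by left; apply/negP; rewrite -leNgt.
  by right; apply/negP; rewrite -leNgt dotpNl oppr_le0 ltW.
have := hemisphere_sarea_lt NS; have := hemisphere_sarea_lt (sphereN NS).
rewrite [X in X <= _ -> _](bigID (fun i => x i != - N)) /=.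
have : \sum_(i | x i != N) mu i <= \sum_(i | ~~ (x i != - N)) mu i.
  rewrite [leRHS](bigID (fun i => x i != N)) /=.
  rewrite (eq_bigl (fun i => ~~ (x i != - N) && (x i != N))) => [|i].
    by rewrite lerDl sumr_ge0 // => i _; exact: ltW.
  by have [//|/xN ->] := eqVneq (x i) N; rewrite ?andbF ?eqxx.
by lra.
Qed.

End Uniqueness.

Section UniquenessMain.
Variables (R : realType) (n K : nat) (sigma : {measure set (BorelR R n) -> \bar R}).
Variables (x : 'I_K -> 'rV[R]_(n.+1)) (mu : 'I_K -> R).
Let S : set (BorelR R n) := sphere R n.

Hypothesis std : standard_sphere_measure sigma.
Hypothesis xS : forall i, sphere R n (x i).
Hypothesis xH : ~ (exists N, sphere R n N /\ forall i, 0 <= dotp (x i) N).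
Hypothesis mu0 : forall i, 0 < mu i.
Hypothesis muS : (\sum_i mu i)%:E = sigma S.
Hypothesis cone : forall V : set 'rV[R]_(n.+1), polyhedral_cone V -> V <> setT ->
  ((\sum_(i | x i \notin V) mu i)%:E > sigma (polar_set (sphere R n `&` V)))%E.
Let fin := sphere_fin muS.

Local Notation H I s := (Hmax x I (expR \o s)).

(* Both minimizers give the cells of I mass at least mu(I); when s' favours I
   over its complement by a gap g > 0, the fattened cells A (of I, for s) and
   B (of ~: I, for s') are disjoint and miss the open set U. *)
Lemma minimizer_unique s s' :
  (forall t, Phi sigma x mu s <= Phi sigma x mu t) ->
  (forall t, Phi sigma x mu s' <= Phi sigma x mu t) ->
  forall i j, s' i - s i = s' j - s j.
Proof.
move=> smin s'min i j; pose d k := s' k - s k.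
have [i0 _ i0max'] := @arg_maxP _ _ _ i predT d isT.
have i0max k : d k <= d i0 by exact: i0max'.
pose I := [set k | d k == d i0]%SET.
have [I0|[j0 j0I]] := set_0Vmem (~: I).
  have dI k : d k = d i0.
    have : k \notin ~: I by rewrite I0 finset.inE.
    by rewrite !finset.inE negbK => /eqP.
  by rewrite -!/(d _) !dI.
have [j1 j1I' j1max'] := @arg_maxP _ _ _ j0 (mem (~: I)) d j0I.
have j1I : j1 \in ~: I by [].
have j1max k : k \in ~: I -> d k <= d j1 by exact: j1max'.
exfalso.
(* The quarter leaves room for four scales: b < e a on [A], b > e^3 a on [B], and a point of the
   sphere with b = e^2 a lies in [U]. *)
pose g := (d i0 - d j1) / 4.
have g0 : 0 < g.
  rewrite divr_gt0 // subr_gt0 lt_def i0max andbT.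
  by move: j1I; rewrite !finset.inE eq_sym.
pose e := expR g; have e1 : 1 < e by rewrite expR_gt1.
pose m := expR (d i0); have m0 : 0 < m by exact: expR_gt0.
pose a := H I s; pose b := H (~: I) s; pose a' := H I s'; pose b' := H (~: I) s'.
have a0 N : 0 <= a N by exact: Hmax_ge0.
have b0 N : 0 <= b N by exact: Hmax_ge0.
have a'E N : a' N = m * a N.
  apply: Hmax_scale => [|k|k|k]; rewrite ?expR_gt0 // finset.inE => /eqP kI /=.
  by rewrite -expRD -kI /d subrK.
(* Outside [I] the difference [d] is at most d i0 - 4 g, whence the factor e^4. *)
have b'E N : e ^+ 4 * b' N <= m * b N.
  rewrite mulrC -ler_pdivlMr ?exprn_gt0 ?expR_gt0 // mulrAC.
  apply: Hmax_scale_le => [|k|k kI]; rewrite ?divr_ge0 ?exprn_ge0 ?expR_ge0 ?expR_gt0 //=.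
  rewrite /e -expRM_natl -expRN -!expRD ler_expR.
  by have := j1max _ kI; rewrite /g /d; lra.
have ab0 N : sphere R n N -> 0 < a N \/ 0 < b N.
  move=> NS; have := Hexp_gt0 xH s NS.
  by move=> /lt_le_trans/(_ (Hmax_setC x I _ N)); rewrite lt_max => /orP.
have ac : continuous a by exact: continuous_Hmax.
have bc : continuous b by exact: continuous_Hmax.
have a'c : continuous a' by exact: continuous_Hmax.
have b'c : continuous b' by exact: continuous_Hmax.
have ec c (f : 'rV[R]_(n.+1) -> R) : continuous f -> continuous (fun N => c * f N).
  by apply: continuous_mul; exact: cst_continuous.
pose A : set (BorelR R n) := [set N | b N < e * a N].
pose B : set (BorelR R n) := [set N | a' N < e * b' N].
pose U : set (BorelR R n) := [set N | e * a N < b N] `&` [set N | e * b' N < a' N].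
have mA : measurable A by apply: measurable_ltfun => //; exact: ec.
have mB : measurable B by apply: measurable_ltfun => //; exact: ec.
have muA : \sum_(k in I) mu k <= sarea sigma A by exact: minimizer_sarea_ge.
have muB : \sum_(k in ~: I) mu k <= sarea sigma B.
  by have := minimizer_sarea_ge xH muS (~: I) s'min g0; rewrite finset.setCK.
have muI : \sum_k mu k = \sum_(k in I) mu k + \sum_(k in ~: I) mu k.
  rewrite (bigID (mem I)) /=; congr (_ + _).
  by apply: eq_bigl => k; rewrite finset.in_setC.
have sumpos (P : pred 'I_K) k : P k -> 0 < \sum_(l | P l) mu l.
  by move=> Pk; rewrite (bigD1 k) //= ltr_wpDr // sumr_ge0 // => l _; exact: ltW.
have i0I : i0 \in I by rewrite finset.inE.
have [NA NAS NAA] := sarea_gt0_nonempty (lt_le_trans (sumpos _ _ i0I) muA).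
have [NB NBS NBB] := sarea_gt0_nonempty (lt_le_trans (sumpos _ _ j1I) muB).
have Bb N : B N -> e ^+ 3 * a N < b N.
  rewrite /B /= a'E => mab; rewrite -(ltr_pM2l m0) mulrCA.
  apply: lt_le_trans (b'E N); rewrite [e ^+ 4]exprSr -mulrA ltr_pM2l //.
  by rewrite exprn_gt0 // expR_gt0.
have AB N : S N -> A N -> B N -> False.
  move=> _; rewrite /A /= => AN /Bb BN; have := a0 N.
  suff : e * a N <= e ^+ 3 * a N by lra.
  by rewrite ler_wpM2r // exprS ler_peMr ?expR_ge0 // exprn_ege1 // ltW.
pose f N := b N - e ^+ 2 * a N.
have fc : continuous f by apply: continuous_sub => //; exact: ec.
have fh c N : 0 <= c -> f (c *: N) = c * f N.
  by move=> c0; rewrite /f /a /b !Hmax_homog //; ring.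
have fA : f NA <= 0.
  rewrite subr_le0; apply: ltW; apply: lt_le_trans NAA _.
  by rewrite ler_wpM2r // expr2 ler_peMr ?expR_ge0 // ltW.
have fB : 0 <= f NB.
  rewrite subr_ge0; apply: ltW; apply: le_lt_trans (Bb _ NBB).
  by rewrite ler_wpM2r // [e ^+ 3]exprS ler_peMl ?exprn_ge0 ?expR_ge0 // ltW.
have [N0 N0S fN0] : exists2 N, sphere R n N & f N = 0.
  (* If [NB] is antipodal to [NA], the path goes through some [x k] different from both, and [f]
     changes sign before or after it. *)
  have [NAB|] := pselect (NB = - NA); last by move=> h; exact: (@sphere_IVT _ _ f NA NB).
  have [k [k1 k2]] := ex_third_point mu0 muS cone NAS.
  have [fk|fk] := leP 0 (f (x k)); first exact: (@sphere_IVT _ _ f NA (x k)).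
  apply: (@sphere_IVT _ _ f (x k) NB) => //; last exact: ltW.
  by rewrite NAB => /oppr_inj/esym.
have N0ab : b N0 = e ^+ 2 * a N0 by move/eqP: fN0; rewrite subr_eq0 => /eqP.
have aN0 : 0 < a N0.
  have [//|] := ab0 _ N0S; rewrite N0ab pmulr_rgt0 //.
  by rewrite exprn_gt0 // expR_gt0.
have N0U : U N0.
  split => /=; first by rewrite N0ab ltr_pM2r // expr2 ltr_pMr // expR_gt0.
  have := b'E N0; rewrite N0ab a'E mulrCA.
  have -> : e ^+ 4 * b' N0 = e ^+ 3 * (e * b' N0) by ring.
  have -> : e ^+ 2 * (m * a N0) = e ^+ 3 * (e^-1 * (m * a N0)).
    by field; rewrite gt_eqF // expR_gt0.
  rewrite ler_pM2l ?exprn_gt0 ?expR_gt0 // => /le_lt_trans; apply.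
  by rewrite gtr_pMl ?mulr_gt0 // invf_lt1 // expR_gt0.
have oU : open (U : set 'rV[R]_(n.+1)).
  by apply: openI; apply: open_ltfun => //; exact: ec.
have s0 : sigma S != 0%E.
  by rewrite -muS eqe gt_eqF // (sumpos predT i).
have U0 := open_sarea_gt0 fin std s0 oU N0S N0U.
have mU : measurable U by exact: measurable_open.
have le1 : sarea sigma A + sarea sigma B <= sarea sigma (A `|` B).
  apply: sarea_disjoint_le => //; first exact: measurableU.
  - by move=> N _ AN; left.
  - by move=> N _ BN; right.
have le2 : sarea sigma (A `|` B) + sarea sigma U <= sarea sigma setT.
  apply: sarea_disjoint_le => //; first exact: measurableU.
  move=> N _ [AN|BN] [/= aU bU].
  - by have := lt_trans AN aU; rewrite ltxx.
  - by have := lt_trans BN bU; rewrite ltxx.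
by move: le1 le2; rewrite (sarea_setT muS) muI; lra.
Qed.

End UniquenessMain.

(** * Polytopes as minimizers *)

Section PolytopeFunctional.
Variables (R : realType) (n K : nat) (sigma : {measure set (BorelR R n) -> \bar R}).
Variables (x : 'I_K -> 'rV[R]_(n.+1)) (mu : 'I_K -> R).
Let S : set (BorelR R n) := sphere R n.

Hypothesis xS : forall i, sphere R n (x i).
Hypothesis xH : ~ (exists N, sphere R n N /\ forall i, 0 <= dotp (x i) N).
Hypothesis mu0 : forall i, 0 < mu i.
Hypothesis muS : (\sum_i mu i)%:E = sigma S.

Lemma admissible_Hexp s : admissible x (Hmax x [set: 'I_K] (expR \o s)) (expR \o s).
Proof.
split => [|N|i|i N NS di]; rewrite /= ?expR_gt0 //.
- exact/continuous_subspaceT/continuous_Hmax.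
- exact: Hexp_gt0.
have := logH_ge s di; rewrite /logH expRK; lra.
Qed.

Lemma QK_Hexp s :
  QK sigma mu (Hmax x [set: 'I_K] (expR \o s)) (expR \o s) = (Phi sigma x mu s)%:E.
Proof.
have [-> _] := admissible_QK xH muS (admissible_Hexp s).
by congr (_ - _)%:E; apply: eq_bigr => i _; rewrite /= expRK.
Qed.

Definition logr P i := ln (radial P (x i)).

Lemma polytope_radial_gt0 P i : polytopeK x P -> 0 < radial P (x i).
Proof. by move=> [J [t [t0 [-> P0]]]]; exact: radial_gt0. Qed.

Lemma polytope_supportE P N : polytopeK x P -> sphere R n N ->
  support_fn P N = Hmax x [set: 'I_K] (expR \o logr P) N.
Proof.
move=> PK NS; rewrite (_ : expR \o logr P = fun i => radial P (x i)).
  by case: PK => J [t [t0 [-> P0]]]; exact: support_Hmax.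
by apply/funext => i /=; rewrite lnK // posrE polytope_radial_gt0.
Qed.

Lemma polytope_QK P : polytopeK x P ->
  QK sigma mu (support_fn P) (fun i => radial P (x i)) = (Phi sigma x mu (logr P))%:E.
Proof.
move=> PK; rewrite -QK_Hexp /QK; congr (_ - _)%E.
  by apply: eq_integral => N /set_mem NS; rewrite polytope_supportE.
by congr (_ %:E); apply: eq_bigr => i _; rewrite /= expRK.
Qed.

(** Some of the points exp(s_i) x_i may lie inside the hull: its radial values are then larger than
    exp(s_i), while its support function never exceeds the maximum of the forms. *)
Lemma Phi_logr_hull s :
  Phi sigma x mu (logr (hull x [set: 'I_K] (expR \o s))) <= Phi sigma x mu s.
Proof.
set P := hull _ _ _; have s0 i : 0 < (expR \o s) i by exact: expR_gt0.
have P0 : (interior P) 0 by exact: hull_interior0.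
have PK : polytopeK x P by exists finset.setT, (expR \o s).
have le : \int[sigma]_(N in S) logH x (logr P) N <= \int[sigma]_(N in S) logH x s N.
  apply: le_Rintegral => //.
  - exact: measurable_sphere.
  - exact: (logH_integrable xH muS).
  - exact: (logH_integrable xH muS).
  move=> N NS; rewrite /logH ler_ln ?posrE ?Hexp_gt0 // -polytope_supportE //.
  apply: support_le => // v Pv; apply: (hull_dotp_le Pv) => i iT.
  exact: (@Hmax_ge _ _ _ x _ (expR \o s)).
apply: lerB => //.
apply: ler_sum => i _; rewrite ler_pM2l // /logr -[s i]expRK.
rewrite ler_ln ?posrE ?expR_gt0 ?polytope_radial_gt0 //.
exact: (le_radial_vertex xS s0 (finset.in_setT i)).
Qed.

End PolytopeFunctional.
Unset Implicit Arguments.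
Theorem theorem4 (R : realType) (n K : nat)
  (sigma : {measure set (BorelR R n) -> \bar R})
  (x : 'I_K -> 'rV[R]_(n.+1)) (mu : 'I_K -> R) :
  standard_sphere_measure sigma ->
  (forall i, sphere R n (x i)) ->
  injective x ->
  (* X_K is not contained in any closed hemisphere *)
  ~ (exists N, sphere R n N /\ forall i, 0 <= dotp (x i) N) ->
  (forall i, 0 < mu i) ->
  (\sum_i mu i)%:E = sigma (sphere R n) ->
  (forall V : set 'rV[R]_(n.+1), polyhedral_cone V -> V <> setT ->
     ((\sum_(i | x i \notin V) mu i)%:E >
        sigma (polar_set (sphere R n `&` V)))%E) ->
  exists P : set 'rV[R]_(n.+1),
    [/\ polytopeK x P,
        QK sigma mu (support_fn P) (fun i => radial P (x i))
          = ereal_inf [set QK sigma mu hp.1 hp.2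
                      | hp in [set hp | admissible x hp.1 hp.2]],
        QK sigma mu (support_fn P) (fun i => radial P (x i))
          = ereal_inf [set QK sigma mu (support_fn P') (fun i => radial P' (x i))
                      | P' in polytopeK x] &
        (* uniqueness up to rescaling *)
        forall P' : set 'rV[R]_(n.+1), polytopeK x P' ->
          QK sigma mu (support_fn P') (fun i => radial P' (x i))
            = QK sigma mu (support_fn P) (fun i => radial P (x i)) ->
          exists2 c : R, 0 < c &
            (forall N, sphere R n N -> support_fn P' N = c * support_fn P N) /\
            (forall y, sphere R n y -> radial P' y = c * radial P y)].
Proof.
move=> std xS _ xH mu0 muS cone.
have [d [d0 dx dgap]] := ex_uniform_gap xS xH mu0 muS cone.
have [s smin] := ex_minimizer xH mu0 muS d0 dx dgap.
have [M MS] := sphere_nonempty R n; have [i0 _] := dx M MS.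
pose P := hull x [set: 'I_K] (expR \o s).
have PK : polytopeK x P.
  exists finset.setT, (expR \o s); split; first by move=> i; exact: expR_gt0.
  by split => //; apply: hull_interior0 => // i; exact: expR_gt0.
have rmin t : Phi sigma x mu (logr x P) <= Phi sigma x mu t.
  exact: le_trans (Phi_logr_hull xS xH mu0 muS s) (smin t).
have QP := polytope_QK xS xH muS PK.
exists P; split => //.
- apply/eqP; rewrite QP eq_le; apply/andP; split.
    apply: le_ereal_inf_tmp => _ [[h p] /= hp <-].
    have [-> le] := admissible_QK xH muS hp.
    by rewrite lee_fin; apply: le_trans (rmin _) le.
  apply: ereal_inf_lbound.
  (* The infimum is attained by the radii of [P] paired with the least [h] admissible for them. *)
  exists (Hmax x [set: 'I_K] (expR \o logr x P), expR \o logr x P).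
    exact: admissible_Hexp.
  exact: QK_Hexp.
- apply/eqP; rewrite QP eq_le; apply/andP; split.
    apply: le_ereal_inf_tmp => _ [P' P'K <-].
    by rewrite (polytope_QK xS xH muS P'K) lee_fin.
  by apply: ereal_inf_lbound; exists P.
move=> P' P'K; rewrite QP (polytope_QK xS xH muS P'K) => -[PhiE].
have r'min t : Phi sigma x mu (logr x P') <= Phi sigma x mu t by rewrite PhiE.
have uniq := minimizer_unique std xS xH mu0 muS cone rmin r'min.
(* The logarithmic radii of [P] and [P'] both minimize [Phi], so they differ by a constant, whose
   exponential is the scaling factor. *)
pose k := logr x P' i0 - logr x P i0.
have suppE N : sphere R n N -> support_fn P' N = expR k * support_fn P N.
  move=> NS; rewrite !(polytope_supportE xS) //.
  apply: Hmax_scale => [|i|i|i _]; rewrite /= ?expR_gt0 //.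
  by rewrite -expRD /k -(uniq i i0) subrK.
exists (expR k); first exact: expR_gt0.
split => // y yS.
have [J [t [t0 [PE P0]]]] := PK; have [J' [t' [t'0 [P'E P'0]]]] := P'K.
rewrite -/(hull x J t) in PE; rewrite -/(hull x J' t') in P'E.
rewrite PE in P0 suppE *; rewrite P'E in P'0 suppE *.
(* Equality of support functions up to scaling gives both inclusions between the scaled bodies, one
   for each inequality. *)
apply/eqP; rewrite eq_le; apply/andP; split.
  by apply: radial_scale_le => // [|N NS]; [exact: expR_gt0|rewrite suppE].
rewrite -ler_pdivlMl ?expR_gt0 //; apply: radial_scale_le => // [|N NS].
  by rewrite invr_gt0 expR_gt0.
by rewrite suppE // mulrA mulVf ?mul1r // gt_eqF // expR_gt0.
Qed.
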